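(* Let $f$ be as in the context, satisfying $f(-x,y)=f(x,y)=f(x,-y)$, let $\beta\in(0,1/2)$, $\kappa=\sqrt{1-2\beta}$, and assume $\tilde f_1(\kappa)\neq0$, $\tilde f_0(2\kappa)\neq0$, and $\nu_a(0,\beta)>0$, where $\nu_a(0,\beta)=\frac{(1-\beta)^2}{4\pi}\big(\tilde f_0(0)-(\tilde f_1(\kappa))^2/\tilde f_0(2\kappa)\big)$. Let $\nu_a(\varepsilon,\beta)$, $\nu_b(\varepsilon,\beta)$ be the real analytic solutions of $a=0$ and $b=0$ respectively, with $\nu_b(0,\beta)=\frac{(1-\beta)^2}{4\pi}\tilde f_0(0)$. Then for small $\varepsilon>0$: at $\nu=\nu_a$ one has $\mathcal R=0$ (total transmission), and at $\nu=\nu_b$ one has $\mathcal T=0$ (total reflection).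
   Context: Let $f:\mathbb R^2\to\mathbb R$ be smooth, $2\pi$-periodic in $y$, vanishing for $|x|>R_0$, with $\int_0^{2\pi}\int_{\mathbb R}f\,dx\,dy>0$. Let $0<\beta<1/2$, $\varepsilon>0$ small, $\omega^2=(1-\beta)^2-\mu^2$ with $\mu=\varepsilon\nu>0$ small. Notation: $f_j(x)=\int_0^{2\pi}e^{-ijy}f(x,y)dy$, $\tilde f_j(\xi)=\int e^{-i\xi x}f_j(x)dx$; $k_0=(1-2\beta-\mu^2)^{1/2}$; $k_m=((\beta+m)^2-(1-\beta)^2+\mu^2)^{1/2}$ for $m\ne0,-1$; kernels $H_0=\frac{i}{2k_0}e^{ik_0|x|}$, $H_{-1}=\frac1{2\mu}(e^{-\mu|x|}-1)$, $H_m=\frac1{2k_m}e^{-k_m|x|}$; $\gamma(\mu,\beta)=\frac1{4\pi}((1-\beta)^2-\mu^2)$; $(\hat T\mathbf A)_m=2\gamma\sum_n(H_n\ast A_n)f_{m-n}$ on sequences $(A_n)_{n\in\mathbb Z}$ of continuous functions supported in $[-R_0,R_0]$; $(\mathbf g^{(1)})_m=e^{ik_0x}f_m$, $(\mathbf g^{(2)})_m=f_{m+1}$; $\langle h\rangle=\int h\,dx$; $F=\langle((1-\varepsilon\hat T)^{-1}\mathbf g^{(2)})_{-1}\rangle$, $Q=\langle((1-\varepsilon\hat T)^{-1}\mathbf g^{(1)})_{-1}\rangle$, $P^\pm=\langle((1-\varepsilon\hat T)^{-1}\mathbf g^{(1)})_0e^{\pm ik_0x}\rangle$. With $\gamma,k_0$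 at $(\varepsilon\nu,\beta)$ and $F,P^\pm,Q$ at $(\varepsilon,\varepsilon\nu,\beta)$: $\ell=\nu-\gamma F$, $a=ik_0^{-1}\varepsilon\gamma\{(\nu-\gamma F)P^++\gamma Q^2\}$, $b=\nu-\gamma F+ik_0^{-1}\varepsilon\gamma\{(\nu-\gamma F)P^-+\gamma Q^2\}$. The reflection and transmission coefficients of the scattering problem (incident wave $e^{i\beta y+ik_0x}$ for $-\nabla^2\Psi=\omega^2(1+\varepsilon f)\Psi$ with $\beta$-quasiperiodicity in $y$) are $\mathcal R=a/\ell$, $\mathcal T=b/\ell$. *)

(* Defs.v *)
From Stdlib Require Import Reals ZArith ClassicalEpsilon.
From Coquelicot Require Import Coquelicot.
Open Scope R_scope.

Definition CInt (g : R -> C) (a b : R) : C := @RInt C_R_CompleteNormedModule g a b.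

Definition cexpi (t : R) : C := (cos t, sin t).

Definition Dx (g : R -> R -> R) : R -> R -> R := fun x y => Derive (fun t => g t y) x.
Definition Dy (g : R -> R -> R) : R -> R -> R := fun x y => Derive (fun t => g x t) y.
Fixpoint iterD (w : list bool) (g : R -> R -> R) : R -> R -> R :=
  match w with
  | nil => g
  | cons b w' => (if b then Dx else Dy) (iterD w' g)
  end.
Definition smooth2 (f : R -> R -> R) : Prop :=
  forall w : list bool,
    (forall p : R * R, continuous (fun q : R * R => iterD w f (fst q) (snd q)) p) /\
    (forall x y, ex_derive (fun t => iterD w f t y) x /\ ex_derive (fun t => iterD w f x t) y).

Definition admissible_f (f : R -> R -> R) (R0 : R) : Prop :=
  smooth2 f /\
  (forall x y, f x (y + 2 * PI) = f x y) /\
  (forall x y, R0 < Rabs x -> f x y = 0) /\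
  0 < RInt (fun y => RInt (fun x => f x y) (- R0) R0) 0 (2 * PI).

Definition fj (f : R -> R -> R) (j : Z) (x : R) : C :=
  CInt (fun y => Cmult (cexpi (- IZR j * y)) (RtoC (f x y))) 0 (2 * PI).
(* tilde f_j(xi) = int e^{-i xi x} f_j(x) dx  (f_j vanishes for |x| > R0) *)
Definition ftilde (f : R -> R -> R) (R0 : R) (j : Z) (xi : R) : C :=
  CInt (fun x => Cmult (cexpi (- xi * x)) (fj f j x)) (- R0) R0.

Definition k0 (mu beta : R) : R := sqrt (1 - 2 * beta - mu ^ 2).
Definition km (mu beta : R) (m : Z) : R :=
  sqrt ((beta + IZR m) ^ 2 - (1 - beta) ^ 2 + mu ^ 2).
Definition gam (mu beta : R) : R := ((1 - beta) ^ 2 - mu ^ 2) / (4 * PI).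

Definition Hk (mu beta : R) (n : Z) (x : R) : C :=
  if Z.eq_dec n 0 then
    Cdiv (Cmult Ci (cexpi (k0 mu beta * Rabs x))) (RtoC (2 * k0 mu beta))
  else if Z.eq_dec n (-1) then
    RtoC ((exp (- mu * Rabs x) - 1) / (2 * mu))
  else RtoC (exp (- km mu beta n * Rabs x) / (2 * km mu beta n)).

Definition inX (R0 : R) (A : Z -> R -> C) : Prop :=
  (forall n x, continuous (A n) x) /\
  (forall n x, R0 < Rabs x -> A n x = RtoC 0) /\
  (exists M, forall n x, Cmod (A n x) <= M).

(* convolution h * a, with a supported in [-R0,R0] *)
Definition conv (R0 : R) (h a : R -> C) (x : R) : C :=
  CInt (fun t => Cmult (h (x - t)) (a t)) (- R0) R0.

Definition zsum (N : nat) (u : Z -> C) : C :=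
  sum_n (fun k => u (Z.of_nat k - Z.of_nat N)%Z) (2 * N).

Definition That_is (f : R -> R -> R) (R0 mu beta : R) (A B : Z -> R -> C) : Prop :=
  forall m x,
    filterlim
      (fun N => zsum N (fun n => Cmult (Cmult (RtoC (2 * gam mu beta))
                                              (conv R0 (Hk mu beta n) (A n) x))
                                       (fj f (m - n)%Z x)))
      eventually (locally (B m x)).

Definition solves (f : R -> R -> R) (R0 eps mu beta : R) (g A : Z -> R -> C) : Prop :=
  inX R0 A /\
  exists B, That_is f R0 mu beta A B /\
            forall m x, A m x = Cplus (g m x) (Cmult (RtoC eps) (B m x)).

(* (1 - eps hat T)^{-1} g : the unique solution (arbitrary if there is none) *)
Definition resolvent (f : R -> R -> R) (R0 eps mu beta : R) (g : Z -> R -> C) : Z -> R -> C :=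
  epsilon (inhabits (fun _ _ => RtoC 0))
    (fun A => solves f R0 eps mu beta g A /\
              forall A', solves f R0 eps mu beta g A' -> A' = A).

Definition g1 (f : R -> R -> R) (mu beta : R) : Z -> R -> C :=
  fun m x => Cmult (cexpi (k0 mu beta * x)) (fj f m x).
Definition g2 (f : R -> R -> R) : Z -> R -> C :=
  fun m x => fj f (m + 1)%Z x.

(* <h> = int h dx, for h supported in [-R0,R0] *)
Definition avg (R0 : R) (h : R -> C) : C := CInt h (- R0) R0.

Definition Fq f R0 eps nu beta : C :=
  avg R0 (resolvent f R0 eps (eps * nu) beta (g2 f) (-1)%Z).
Definition Qq f R0 eps nu beta : C :=
  avg R0 (resolvent f R0 eps (eps * nu) beta (g1 f (eps * nu) beta) (-1)%Z).
Definition Pp f R0 eps nu beta : C :=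
  avg R0 (fun x => Cmult (resolvent f R0 eps (eps * nu) beta (g1 f (eps * nu) beta) 0%Z x)
                         (cexpi (k0 (eps * nu) beta * x))).
Definition Pm f R0 eps nu beta : C :=
  avg R0 (fun x => Cmult (resolvent f R0 eps (eps * nu) beta (g1 f (eps * nu) beta) 0%Z x)
                         (cexpi (- (k0 (eps * nu) beta * x)))).

Definition ell f R0 eps nu beta : C :=
  Cminus (RtoC nu) (Cmult (RtoC (gam (eps * nu) beta)) (Fq f R0 eps nu beta)).
Definition acoef f R0 eps nu beta : C :=
  Cmult (Cmult (Cdiv Ci (RtoC (k0 (eps * nu) beta))) (RtoC (eps * gam (eps * nu) beta)))
    (Cplus (Cmult (ell f R0 eps nu beta) (Pp f R0 eps nu beta))
           (Cmult (RtoC (gam (eps * nu) beta))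
                  (Cmult (Qq f R0 eps nu beta) (Qq f R0 eps nu beta)))).
Definition bcoef f R0 eps nu beta : C :=
  Cplus (ell f R0 eps nu beta)
   (Cmult (Cmult (Cdiv Ci (RtoC (k0 (eps * nu) beta))) (RtoC (eps * gam (eps * nu) beta)))
    (Cplus (Cmult (ell f R0 eps nu beta) (Pm f R0 eps nu beta))
           (Cmult (RtoC (gam (eps * nu) beta))
                  (Cmult (Qq f R0 eps nu beta) (Qq f R0 eps nu beta))))).

Definition Rcoef f R0 eps nu beta : C := Cdiv (acoef f R0 eps nu beta) (ell f R0 eps nu beta).
Definition Tcoef f R0 eps nu beta : C := Cdiv (bcoef f R0 eps nu beta) (ell f R0 eps nu beta).

Definition real_analytic_on (g : R -> R) (a b : R) : Prop :=
  forall x0, a < x0 < b ->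
    exists (c : nat -> R) (r : R), 0 < r /\
      forall x, Rabs (x - x0) < r -> @is_pseries R_AbsRing R_NormedModule c (x - x0) (g x).

Definition nu_a0 f R0 beta : R :=
  (1 - beta) ^ 2 / (4 * PI) *
  Re (Cminus (ftilde f R0 0 0)
             (Cdiv (Cmult (ftilde f R0 1 (sqrt (1 - 2 * beta))) (ftilde f R0 1 (sqrt (1 - 2 * beta))))
                   (ftilde f R0 0 (2 * sqrt (1 - 2 * beta))))).
Definition nu_b0 f R0 beta : R := (1 - beta) ^ 2 / (4 * PI) * Re (ftilde f R0 0 0).

(* Main.v *)
Require Import Defs.
From Stdlib Require Import Reals ZArith Lra Lia Classical FunctionalExtensionality ClassicalEpsilon.
From Coquelicot Require Import Coquelicot.
Open Scope R_scope.

(** Idea.  Both equations force [ell <> 0] as soon as [Q <> 0]: if [ell = 0], then [a = 0] and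
    [b = 0] each reduce to [i k_0^-1 eps gamma^2 Q^2 = 0].  As [eps -> 0] with [mu = eps nu -> 0],
    [Q] tends to the integral of [e^{i kappa x} f_{-1}], which by the symmetries of [f] is
    [ftilde_1 kappa <> 0].

    The limit rests on bounds for the resolvent that are uniform in small [mu].  On
    [[-2 R0, 2 R0]] the kernels [H_n] are bounded and Lipschitz uniformly in [n] and [mu] (also for
    [mu <= 0], so the sign of [nu] plays no role), and two integrations by parts give summable
    bounds for [f_j] and its Lipschitz constant.  So [eps T] is a contraction of the space of
    bounded sequences of continuous functions when [eps] is small, and [(1 - eps T)^{-1} g] is
    within [O(eps)] of [g]. *)

(** * Symmetric sums and the contraction principle *)

(** Along the two branches the numerators vanish by hypothesis, so both quotients are 0 whatever
    value the total division gives them; the mathematical content is [ell <> 0], which the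
    conclusion therefore states beside each zero. The obstacle is that [resolvent] is an epsilon
    term: nothing is known about it until the equation has exactly one solution in [inX]. Since
    [mu = eps * nu] moves with [eps], the threshold on [eps] that ensures this must not depend on
    [mu]. The delicate kernel is [H_{-1}] with its factor [1 / mu]: subtracting 1 makes it vanish at
    [x = 0], and its slope in [|x|] is [- e^{- mu |x|} / 2], so it stays bounded as [mu] tends to 0.
    Analyticity of a branch enters through continuity at 0, which bounds [nu] and makes [mu] of
    order [eps]. The estimate of [Q] is in terms of [|eps| + |mu|] for arbitrary [nu], so it serves
    both branches. *)

Lemma filterlim_Cmod {T : Type} (F : (T -> Prop) -> Prop) {FF : Filter F}
  (v : T -> C) (l : C) :
  filterlim v F (locally l) <->
  forall eps : posreal, F (fun t => Cmod (v t - l) < eps).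
Proof.
  generalize (filterlim_locally_ball_norm (K := C_AbsRing) (U := C_NormedModule) (F := F) v l).
  (* The norm of [C_NormedModule] is [Cmod] by conversion. *)
  exact (fun H => H).
Qed.

Lemma continuous_Cmod (g : R -> C) (x : R) :
  continuous g x <->
  forall eps : posreal, exists delta : posreal,
    forall y, Rabs (y - x) < delta -> Cmod (g y - g x) < eps.
Proof.
  exact (filterlim_Cmod (locally x) g (g x)).
Qed.

Lemma Ccv_Cmod (v : nat -> C) (l : C) :
  filterlim v eventually (locally l) <->
  forall eps : posreal, exists N, forall n, (N <= n)%nat -> Cmod (v n - l) < eps.
Proof.
  exact (filterlim_Cmod eventually v l).
Qed.

Lemma Ccv_unique (v : nat -> C) (l l' : C) :
  filterlim v eventually (locally l) -> filterlim v eventually (locally l') -> l = l'.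
Proof.
  intros H H'.
  exact (filterlim_locally_unique (V := C_NormedModule) v l l' H H').
Qed.

Lemma Ccv_minus (v w : nat -> C) (l l' : C) :
  filterlim v eventually (locally l) -> filterlim w eventually (locally l') ->
  filterlim (fun n => (v n - w n)%C) eventually (locally (l - l')%C).
Proof.
  rewrite !Ccv_Cmod. intros H H' eps.
  destruct (H (pos_div_2 eps)) as [N1 H1]. destruct (H' (pos_div_2 eps)) as [N2 H2].
  exists (N1 + N2)%nat. intros n Hn.
  replace (v n - w n - (l - l'))%C with ((v n - l) + - (w n - l'))%C by ring.
  eapply Rle_lt_trans; [apply Cmod_triangle|]. rewrite Cmod_opp.
  specialize (H1 n ltac:(lia)). specialize (H2 n ltac:(lia)). simpl in *. lra.
Qed.

Lemma Ccv_bound (v : nat -> C) (l : C) (M : R) :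
  filterlim v eventually (locally l) -> (forall n, Cmod (v n) <= M) -> Cmod l <= M.
Proof.
  rewrite Ccv_Cmod. intros H HM. apply le_epsilon. intros e He.
  destruct (H (mkposreal e He)) as [N HN]. specialize (HN N (le_n N)). simpl in HN.
  replace l with (v N + - (v N - l))%C by ring.
  eapply Rle_trans; [apply Cmod_triangle|]. rewrite Cmod_opp. specialize (HM N). lra.
Qed.

(** Comparison with the increasing bounded sequence [s]. The explicit error [M - s n] gives the rate
    of the fixed-point iteration; the mere convergence serves the symmetric sums. *)
Lemma Ccv_dominated (v : nat -> C) (s : nat -> R) (M : R) :
  (forall n, Cmod (v (S n) - v n) <= s (S n) - s n) -> (forall n, s n <= M) ->
  exists l, filterlim v eventually (locally l) /\ forall n, Cmod (l - v n) <= M - s n.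
Proof.
  intros Hv HM.
  assert (Hvp : forall n p, Cmod (v (n + p)%nat - v n) <= s (n + p)%nat - s n).
  { intros n p. induction p as [|p IH].
    - rewrite Nat.add_0_r.
      replace (v n - v n)%C with (RtoC 0) by ring. rewrite Cmod_0. lra.
    - rewrite Nat.add_succ_r.
      replace (v (S (n + p)) - v n)%C
        with ((v (S (n + p)) - v (n + p)%nat) + (v (n + p)%nat - v n))%C by ring.
      eapply Rle_trans; [apply Cmod_triangle|]. specialize (Hv (n + p)%nat). lra. }
  assert (Hs : forall n, s n <= s (S n)).
  { intro n. specialize (Hv n). pose proof (Cmod_ge_0 (v (S n) - v n)). lra. }
  destruct (ex_finite_lim_seq_incr s M Hs HM) as [L HL].
  assert (HC : exists l : C, filterlim v eventually (locally l)).
  { apply (proj1 (filterlim_locally_cauchy (U := C_CompleteNormedModule) (F := eventually) v)).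
    intro eps.
    apply is_lim_seq_spec in HL. destruct (HL (pos_div_2 (pos_div_2 eps))) as [N HN].
    exists (fun n => (N <= n)%nat). split; [exists N; auto|].
    assert (HNp : forall n, (N <= n)%nat -> Cmod (v n - v N) < eps / 2).
    { intros n Hn. replace n with (N + (n - N))%nat by lia.
      eapply Rle_lt_trans; [apply Hvp|].
      replace (N + (n - N))%nat with n by lia.
      pose proof (HN n Hn) as H1. pose proof (HN N (le_n N)) as H2. simpl in H1, H2.
      apply Rabs_def2 in H1. apply Rabs_def2 in H2. lra. }
    intros n n' Hn Hn'.
    apply (norm_compat1 (V := C_NormedModule)).
    change (Cmod (v n' - v n) < eps).
    replace (v n' - v n)%C with ((v n' - v N) + - (v n - v N))%C by ring.
    eapply Rle_lt_trans; [apply Cmod_triangle|]. rewrite Cmod_opp.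
    specialize (HNp n Hn) as H1. specialize (HNp n' Hn') as H2. lra. }
  destruct HC as [l Hl]. exists l. split; [exact Hl|].
  intro n.
  (* Let [p] tend to infinity in [Hvp]. *)
  apply Ccv_bound with (v := fun p => (v (n + p)%nat - v n)%C).
  - apply Ccv_Cmod. intro eps. destruct (proj1 (Ccv_Cmod v l) Hl eps) as [N HN].
    exists N. intros p Hp.
    replace (v (n + p)%nat - v n - (l - v n))%C with (v (n + p)%nat - l)%C by ring.
    apply HN. lia.
  - intro p. eapply Rle_trans; [apply Hvp|]. specialize (HM (n + p)%nat). lra.
Qed.

Definition zsumR (N : nat) (u : Z -> R) : R :=
  sum_n (fun k => u (Z.of_nat k - Z.of_nat N)%Z) (2 * N).

(** Enlarging the window adds one term at each end. Stated for an abelian group so that it covers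
    the complex and the real sums, whose lemmas then go by induction on [N]. *)
Lemma sum_n_symmetric_S {G : AbelianGroup} (u : Z -> G) (N : nat) :
  sum_n (fun k => u (Z.of_nat k - Z.of_nat (S N))%Z) (2 * S N) =
  plus (plus (u (- Z.of_nat (S N))%Z) (sum_n (fun k => u (Z.of_nat k - Z.of_nat N)%Z) (2 * N)))
       (u (Z.of_nat (S N))).
Proof.
  replace (2 * S N)%nat with (S (S (2 * N))) by lia.
  rewrite sum_Sn. unfold sum_n at 1. rewrite sum_Sn_m by lia.
  rewrite <- (sum_n_m_S (fun k => u (Z.of_nat k - Z.of_nat (S N))%Z)).
  f_equal; [f_equal|].
  - apply sum_n_m_ext. intro k. f_equal. lia.
  - f_equal. lia.
Qed.

Lemma zsum_S (u : Z -> C) (N : nat) :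
  zsum (S N) u = (u (- Z.of_nat (S N))%Z + zsum N u + u (Z.of_nat (S N)))%C.
Proof. exact (sum_n_symmetric_S u N). Qed.

Lemma zsumR_S (u : Z -> R) (N : nat) :
  zsumR (S N) u = u (- Z.of_nat (S N))%Z + zsumR N u + u (Z.of_nat (S N)).
Proof. exact (sum_n_symmetric_S u N). Qed.

Lemma zsum_0 (u : Z -> C) : zsum 0 u = u 0%Z.
Proof. unfold zsum. simpl. rewrite sum_O. reflexivity. Qed.

Lemma zsumR_0 (u : Z -> R) : zsumR 0 u = u 0%Z.
Proof. unfold zsumR. simpl. rewrite sum_O. reflexivity. Qed.

Lemma zsum_minus (u v : Z -> C) (N : nat) :
  zsum N (fun n => u n - v n)%C = (zsum N u - zsum N v)%C.
Proof.
  induction N as [|N IH]; [now rewrite !zsum_0|]. rewrite !zsum_S, IH. ring.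
Qed.

Lemma zsum_le (u : Z -> C) (w : Z -> R) (N : nat) :
  (forall n, Cmod (u n) <= w n) -> Cmod (zsum N u) <= zsumR N w.
Proof.
  intro H. induction N as [|N IH]; [rewrite zsum_0, zsumR_0; apply H|].
  rewrite zsum_S, zsumR_S.
  eapply Rle_trans; [apply Cmod_triangle|].
  apply Rplus_le_compat; [|apply H].
  eapply Rle_trans; [apply Cmod_triangle|].
  apply Rplus_le_compat; [apply H|exact IH].
Qed.

Lemma zsumR_scal (c : R) (w : Z -> R) (N : nat) :
  zsumR N (fun n => c * w n) = c * zsumR N w.
Proof.
  induction N as [|N IH]; [now rewrite !zsumR_0|]. rewrite !zsumR_S, IH. ring.
Qed.

Lemma zsum_dominated_cv (u : Z -> C) (w : Z -> R) (M : R) :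
  (forall n, Cmod (u n) <= w n) -> (forall N, zsumR N w <= M) ->
  exists l, filterlim (fun N => zsum N u) eventually (locally l).
Proof.
  intros Hu HM.
  destruct (Ccv_dominated (fun N => zsum N u) (fun N => zsumR N w) M) as [l [Hl _]].
  - intro N. rewrite zsum_S, zsumR_S.
    match goal with |- Cmod ?z <= _ =>
      replace z with (u (- Z.of_nat (S N))%Z + u (Z.of_nat (S N)))%C by ring end.
    eapply Rle_trans; [apply Cmod_triangle|].
    pose proof (Hu (- Z.of_nat (S N))%Z). pose proof (Hu (Z.of_nat (S N))). lra.
  - exact HM.
  - exists l. exact Hl.
Qed.

(* Increments of the bounded function [j / (1 + |j|)]: their sums telescope, so every shift has the
   same bound, and they decay like [1 / j^2]. *)
Definition zweight (j : Z) : R :=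
  IZR (j + 1) / (1 + Rabs (IZR (j + 1))) - IZR j / (1 + Rabs (IZR j)).

Lemma IZR_over_bound (j : Z) : Rabs (IZR j / (1 + Rabs (IZR j))) <= 1.
Proof.
  pose proof (Rabs_pos (IZR j)).
  rewrite Rabs_div by lra. rewrite (Rabs_pos_eq (1 + _)) by lra.
  apply Rle_div_l; lra.
Qed.

Lemma zsumR_zweight (m : Z) (N : nat) : zsumR N (fun n => zweight (m - n)) <= 2.
Proof.
  set (phi := fun j : Z => IZR j / (1 + Rabs (IZR j))).
  assert (H : zsumR N (fun n => zweight (m - n))
              = phi (m + Z.of_nat N + 1)%Z - phi (m - Z.of_nat N)%Z).
  { induction N as [|N IH].
    - rewrite zsumR_0. unfold zweight, phi. rewrite Z.add_0_r, !Z.sub_0_r. reflexivity.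
    - rewrite zsumR_S, IH. unfold zweight. fold (phi (m - - Z.of_nat (S N))%Z).
      fold (phi (m - - Z.of_nat (S N) + 1)%Z). fold (phi (m - Z.of_nat (S N))%Z).
      fold (phi (m - Z.of_nat (S N) + 1)%Z).
      replace (m - - Z.of_nat (S N))%Z with (m + Z.of_nat N + 1)%Z by lia.
      replace (m - Z.of_nat (S N) + 1)%Z with (m - Z.of_nat N)%Z by lia.
      replace (m + Z.of_nat (S N) + 1)%Z with (m + Z.of_nat N + 1 + 1)%Z by lia.
      ring. }
  rewrite H. unfold phi.
  pose proof (IZR_over_bound (m + Z.of_nat N + 1)) as H1.
  pose proof (IZR_over_bound (m - Z.of_nat N)) as H2.
  apply Rabs_le_between in H1. apply Rabs_le_between in H2. lra.
Qed.

(* [zweight j] is [1 / ((j+1)(j+2))] for [j >= 0] and [1 / (k(k+1))] for [j = -k < 0]. *)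
Lemma zweight_lower (j : Z) : 1 <= 6 * IZR j ^ 2 * zweight j \/ (j = 0%Z /\ zweight j = 1 / 2).
Proof.
  unfold zweight. rewrite plus_IZR.
  destruct (Z_lt_le_dec j 0) as [Hj|Hj]; [|destruct (Z.eq_dec j 0) as [->|Hj0]].
  - left. apply Z.lt_le_pred in Hj. apply IZR_le in Hj. simpl in Hj.
    set (x := IZR j) in *.
    rewrite (Rabs_left1 x), (Rabs_left1 (x + 1)) by lra.
    replace (6 * x ^ 2 * ((x + 1) / (1 + - (x + 1)) - x / (1 + - x)))
      with (6 * (- x) / (1 - x)) by (field; lra).
    apply Rle_div_r; lra.
  - right. split; [reflexivity|]. rewrite Rabs_R0, Rplus_0_l, Rabs_R1. field.
  - left. assert (H1 : (1 <= j)%Z) by lia. apply IZR_le in H1. set (x := IZR j) in *.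
    rewrite !Rabs_pos_eq by lra.
    replace (6 * x ^ 2 * ((x + 1) / (1 + (x + 1)) - x / (1 + x)))
      with (6 * x ^ 2 / ((x + 1) * (x + 2))) by (field; lra).
    apply Rle_div_r; nra.
Qed.

(** Banach's theorem in the sup norm with all bounds pointwise: completeness comes from pointwise
    limits in [C], and stability of [S] under uniform approximation puts the limit back into [S]. *)
Lemma contraction_fixpoint {I J : Type} (S : (I -> J -> C) -> Prop)
  (Phi : (I -> J -> C) -> I -> J -> C) (q D : R) (A0 : I -> J -> C) :
  0 <= q < 1 ->
  (forall A, S A -> S (Phi A)) ->
  (forall A B M, S A -> S B -> (forall i j, Cmod (A i j - B i j) <= M) ->
     forall i j, Cmod (Phi A i j - Phi B i j) <= q * M) ->
  (forall A, (forall delta : posreal, exists B, S B /\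
     forall i j, Cmod (A i j - B i j) <= delta) -> S A) ->
  S A0 -> (forall i j, Cmod (Phi A0 i j - A0 i j) <= D) ->
  exists A, S A /\ (forall i j, Phi A i j = A i j) /\
    forall i j, Cmod (A i j - A0 i j) <= D / (1 - q).
Proof.
  intros Hq HSP Hcontr Hcl HA0 HD.
  set (it := fun n => Nat.iter n Phi A0).
  assert (HSit : forall n, S (it n)).
  { induction n as [|n IH]; [exact HA0|]. apply HSP, IH. }
  assert (Hit : forall n i j, Cmod (it (Datatypes.S n) i j - it n i j) <= q ^ n * D).
  { induction n as [|n IH]; intros i j; [simpl; rewrite Rmult_1_l; apply HD|].
    simpl pow. rewrite Rmult_assoc.
    exact (Hcontr (it (Datatypes.S n)) (it n) _ (HSit _) (HSit _) IH i j). }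
  (* Partial sums of the geometric series [D * q ^ k]. *)
  set (s := fun n => D * (1 - q ^ n) / (1 - q)).
  (* [I] or [J] may be empty, so [0 <= D] is known only once a pair of indices is given. *)
  assert (HD0 : forall i : I, forall j : J, 0 <= D)
    by (intros i j; eapply Rle_trans; [apply Cmod_ge_0|apply (HD i j)]).
  assert (Hlim : forall i j, exists l, forall n, Cmod (l - it n i j) <= D / (1 - q) - s n).
  { intros i j.
    destruct (Ccv_dominated (fun n => it n i j) s (D / (1 - q))) as [l [_ Hl]].
    - intro n. eapply Rle_trans; [apply Hit|]. apply Req_le. unfold s. simpl. field. lra.
    - intro n. unfold s. apply Rmult_le_compat_r; [left; apply Rinv_0_lt_compat; lra|].
      pose proof (pow_le q n ltac:(lra)). specialize (HD0 i j). nra.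
    - exists l. exact Hl. }
  set (A := fun i j => proj1_sig (constructive_indefinite_description _ (Hlim i j))).
  assert (HA : forall i j n, Cmod (A i j - it n i j) <= D / (1 - q) * q ^ n).
  { intros i j n. unfold A.
    destruct (constructive_indefinite_description _ (Hlim i j)) as [l Hl]. simpl.
    eapply Rle_trans; [apply Hl|]. apply Req_le. unfold s. field. lra. }
  assert (Hsmall : forall i : I, forall j : J, forall delta : posreal, exists n, D / (1 - q) * q ^ n <= delta).
  { intros i j delta. specialize (HD0 i j).
    assert (HE : 0 <= D / (1 - q)) by (apply Rmult_le_pos; [lra|left; apply Rinv_0_lt_compat; lra]).
    (* The [+ 1] keeps the denominator positive when [D = 0]. *)
    destruct (pow_lt_1_zero q ltac:(rewrite Rabs_pos_eq; lra) (delta / (D / (1 - q) + 1)))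
      as [n Hn].
    { apply Rdiv_lt_0_compat; [apply cond_pos|lra]. }
    exists n. specialize (Hn n (le_n n)). apply Rabs_def2 in Hn.
    destruct Hn as [Hn _]. apply Rlt_div_r in Hn; [|lra].
    pose proof (pow_le q n ltac:(lra)). nra. }
  assert (HSA : S A).
  { apply Hcl. intro delta.
    destruct (classic (exists (i : I) (j : J), True)) as [[i0 [j0 _]]|Hempty].
    - destruct (Hsmall i0 j0 delta) as [n Hn]. exists (it n). split; [apply HSit|].
      intros i j. eapply Rle_trans; [apply HA|exact Hn].
    - exists A0. split; [exact HA0|]. intros i j. exfalso. apply Hempty. now exists i, j. }
  exists A. split; [exact HSA|]. split.
  - intros i j.
    assert (Hz : Cmod (Phi A i j - A i j) <= 0).
    { apply le_epsilon. intros e He.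
      (* Both [Phi A] and [A] lie within [D / (1 - q) * q ^ n] of the iterate [n + 1], hence the
         halved tolerance. *)
      destruct (Hsmall i j (mkposreal (e / 2) ltac:(lra))) as [n Hn]. simpl in Hn.
      replace (Phi A i j - A i j)%C
        with ((Phi A i j - it (Datatypes.S n) i j) + - (A i j - it (Datatypes.S n) i j))%C by ring.
      eapply Rle_trans; [apply Cmod_triangle|]. rewrite Cmod_opp.
      pose proof (Hcontr A (it n) _ HSA (HSit n) (fun i j => HA i j n) i j) as H1.
      pose proof (HA i j (Datatypes.S n)) as H2. simpl pow in H2.
      change (it (Datatypes.S n)) with (Phi (it n)) in *.
      assert (0 <= D / (1 - q) * q ^ n).
      { eapply Rle_trans; [apply Cmod_ge_0|apply (HA i j n)]. }
      nra. }
    pose proof (Cmod_ge_0 (Phi A i j - A i j)).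
    assert (Hm : (Phi A i j - A i j = 0)%C) by (apply Cmod_eq_0; lra).
    replace (Phi A i j) with ((Phi A i j - A i j) + A i j)%C by ring.
    rewrite Hm. ring.
  - intros i j. eapply Rle_trans; [apply (HA i j 0%nat)|]. simpl. lra.
Qed.

(** * Complex-valued integrals *)

Lemma continuous_C (g : R -> C) (x : R) :
  continuous g x <->
  continuous (fun t => fst (g t)) x /\ continuous (fun t => snd (g t)) x.
Proof.
  split.
  - intro H. split.
    + apply (continuous_comp (V := C_UniformSpace) g fst); [exact H|apply continuous_fst].
    + apply (continuous_comp (V := C_UniformSpace) g snd); [exact H|apply continuous_snd].
  - intros [H1 H2].
    apply (continuous_ext (U := C_UniformSpace) (fun t => (fst (g t), snd (g t)) : C)).
    + intro t. now destruct (g t).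
    + apply (continuous_comp_2 (X := C_UniformSpace) _ _ (fun a b => (a, b)) x H1 H2).
      apply (continuous_ext (U := C_UniformSpace) (T := prod_UniformSpace R_UniformSpace R_UniformSpace)
               (fun z => z)).
      * now intros [a b].
      * apply continuous_id.
Qed.

Lemma continuous_Cmult (g h : R -> C) (x : R) :
  continuous g x -> continuous h x -> continuous (fun t => (g t * h t)%C) x.
Proof.
  rewrite !continuous_C. intros [G1 G2] [H1 H2]. split; unfold Cmult; simpl.
  - apply (continuous_minus (V := R_NormedModule)).
    + now apply (continuous_mult (K := R_AbsRing)).
    + now apply (continuous_mult (K := R_AbsRing)).
  - apply (continuous_plus (V := R_NormedModule)).
    + now apply (continuous_mult (K := R_AbsRing)).
    + now apply (continuous_mult (K := R_AbsRing)).
Qed.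

Lemma continuous_cexpi (h : R -> R) (x : R) :
  continuous h x -> continuous (fun t => cexpi (h t)) x.
Proof.
  intro H. apply continuous_C. split; simpl.
  - now apply continuous_cos_comp.
  - now apply continuous_sin_comp.
Qed.

Lemma continuous_RtoC (h : R -> R) (x : R) :
  continuous h x -> continuous (fun t => RtoC (h t)) x.
Proof.
  intro H. apply continuous_C. split; simpl; [exact H|apply continuous_const].
Qed.

Lemma continuous_C_lipschitz (g : R -> C) (L x : R) :
  (forall y, Cmod (g y - g x) <= L * Rabs (y - x)) -> continuous g x.
Proof.
  intro H. apply continuous_Cmod. intro eps.
  assert (HL : 0 < Rabs L + 1) by (pose proof (Rabs_pos L); lra).
  exists (mkposreal (eps / (Rabs L + 1)) (Rdiv_lt_0_compat _ _ (cond_pos eps) HL)).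
  intros y Hy. simpl in Hy. apply Rlt_div_r in Hy; [|exact HL].
  eapply Rle_lt_trans; [apply H|]. pose proof (Rle_abs L). pose proof (Rabs_pos (y - x)). nra.
Qed.

Lemma Cmod_cexpi (t : R) : Cmod (cexpi t) = 1.
Proof.
  unfold Cmod, cexpi. simpl fst. simpl snd.
  replace (cos t ^ 2 + sin t ^ 2) with 1; [apply sqrt_1|].
  pose proof (sin2_cos2 t). unfold Rsqr in *. lra.
Qed.

Lemma Cmod_le_sum (z : C) : Cmod z <= Rabs (fst z) + Rabs (snd z).
Proof.
  replace z with (RtoC (fst z) + Ci * RtoC (snd z))%C.
  - eapply Rle_trans; [apply Cmod_triangle|].
    rewrite Cmod_mult, !Cmod_R, Cmod_Ci. simpl. rewrite Rmult_1_l.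
    apply Req_le. f_equal; f_equal; ring.
  - destruct z as [a b]. unfold Cplus, Cmult, Ci, RtoC. simpl. f_equal; ring.
Qed.

Lemma Rlipschitz_derive (g g' : R -> R) (a b M : R) :
  (forall x, Rmin a b <= x <= Rmax a b -> is_derive g x (g' x)) ->
  (forall x, Rmin a b <= x <= Rmax a b -> Rabs (g' x) <= M) ->
  Rabs (g b - g a) <= M * Rabs (b - a).
Proof.
  intros Hd HM. destruct (MVT_gen g a b g') as [c [Hc ->]].
  - intros x Hx. apply Hd. lra.
  - intros x Hx. apply continuity_pt_filterlim, (ex_derive_continuous g). eexists. now apply Hd.
  - rewrite Rabs_mult. apply Rmult_le_compat_r; [apply Rabs_pos|]. now apply HM.
Qed.

(** The constant 2 adds the bounds for the cosine and the sine. *)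
Lemma cexpi_lipschitz (s t : R) : Cmod (cexpi s - cexpi t) <= 2 * Rabs (s - t).
Proof.
  eapply Rle_trans; [apply Cmod_le_sum|]. unfold cexpi. simpl.
  assert (H1 : Rabs (cos s - cos t) <= 1 * Rabs (s - t)).
  { apply Rlipschitz_derive with (g' := fun x => - sin x); intros x _.
    - apply is_derive_Reals, derivable_pt_lim_cos.
    - rewrite Rabs_Ropp. apply Rabs_le, SIN_bound. }
  assert (H2 : Rabs (sin s - sin t) <= 1 * Rabs (s - t)).
  { apply Rlipschitz_derive with (g' := fun x => cos x); intros x _.
    - apply is_derive_Reals, derivable_pt_lim_sin.
    - apply Rabs_le, COS_bound. }
  unfold Rminus in *. lra.
Qed.

Lemma ex_CInt_continuous (g : R -> C) (a b : R) :
  (forall t, continuous g t) -> @ex_RInt C_R_CompleteNormedModule g a b.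
Proof.
  intro H. apply (ex_RInt_continuous (V := C_R_CompleteNormedModule)).
  intros z _. apply H.
Qed.

(** [CInt] integrates in [C] as a real normed module; this translates the norm bounds available
    there into [Cmod]. *)
Lemma norm_C_R (z : C) : @norm R_AbsRing C_R_NormedModule z = Cmod z.
Proof.
  unfold Cmod. rewrite <- (pow2_abs (fst z)), <- (pow2_abs (snd z)). reflexivity.
Qed.

Lemma Cmod_CInt_le (g : R -> C) (a b M : R) :
  a <= b -> (forall t, continuous g t) -> (forall t, a <= t <= b -> Cmod (g t) <= M) ->
  Cmod (CInt g a b) <= (b - a) * M.
Proof.
  intros Hab Hg HM. rewrite <- norm_C_R.
  apply (norm_RInt_le_const (V := C_R_NormedModule) g a b); [exact Hab| |].
  - intros t Ht. rewrite norm_C_R. now apply HM.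
  - apply (RInt_correct (V := C_R_CompleteNormedModule)). now apply ex_CInt_continuous.
Qed.

Lemma CInt_0 (g : R -> C) (a b : R) : (forall t, g t = RtoC 0) -> CInt g a b = RtoC 0.
Proof.
  intro Hg. transitivity (CInt (fun _ => RtoC 0) a b).
  - apply (RInt_ext (V := C_R_CompleteNormedModule)). intros t _. apply Hg.
  - unfold CInt. rewrite RInt_const. exact (scal_zero_r (V := C_R_CompleteNormedModule) _).
Qed.

Lemma CInt_minus (g h : R -> C) (a b : R) :
  (forall t, continuous g t) -> (forall t, continuous h t) ->
  CInt (fun t => g t - h t)%C a b = (CInt g a b - CInt h a b)%C.
Proof.
  intros Hg Hh.
  exact (RInt_minus (V := C_R_CompleteNormedModule) g h a b
           (ex_CInt_continuous g a b Hg) (ex_CInt_continuous h a b Hh)).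
Qed.

(** Gives access to the real integrals, on which the integration by parts is carried out. *)
Lemma CInt_pair (g : R -> C) (a b : R) :
  (forall t, continuous g t) ->
  CInt g a b = (RInt (fun t => fst (g t)) a b, RInt (fun t => snd (g t)) a b).
Proof.
  intro Hg. symmetry.
  apply (RInt_fct_extend_pair (U := R_NormedModule) (V := R_NormedModule)
           (fun h a b => RInt h a b) (fun h a b => RInt h a b)).
  - intros. now apply is_RInt_unique.
  - intros. now apply is_RInt_unique.
  - apply (RInt_correct (V := C_R_CompleteNormedModule)). now apply ex_CInt_continuous.
Qed.

Lemma continuous_Cminus (g h : R -> C) (x : R) :
  continuous g x -> continuous h x -> continuous (fun t => (g t - h t)%C) x.
Proof.
  rewrite !continuous_C. intros [G1 G2] [H1 H2]. split; simpl.
  - now apply (continuous_minus (V := R_NormedModule)).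
  - now apply (continuous_minus (V := R_NormedModule)).
Qed.

Lemma Cmod_CInt_minus_le (g h : R -> C) (a b M : R) :
  a <= b -> (forall t, continuous g t) -> (forall t, continuous h t) ->
  (forall t, a <= t <= b -> Cmod (g t - h t) <= M) ->
  Cmod (CInt g a b - CInt h a b) <= (b - a) * M.
Proof.
  intros Hab Hg Hh HM. rewrite <- CInt_minus by assumption.
  apply Cmod_CInt_le; auto. intro t. now apply continuous_Cminus.
Qed.

(** * The convolution operator *)

Lemma conv_integrand_continuous (h a : R -> C) (x : R) :
  (forall t, continuous h t) -> (forall t, continuous a t) ->
  forall s, continuous (fun t : R => (h (x - t)%R * a t)%C) s.
Proof.
  intros Hh Ha t. apply continuous_Cmult; [|apply Ha].
  apply (continuous_comp (V := R_UniformSpace) (W := C_UniformSpace) (fun t => x - t) h).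
  - apply (continuous_minus (V := R_NormedModule)); [apply continuous_const|apply continuous_id].
  - apply Hh.
Qed.

Section Operator.

Context (R0 K W : R) (G : C) (H c : Z -> R -> C).
Context (HR0 : 0 <= R0) (HK : 0 <= K) (HW : 0 <= W).
Context (Hcont : forall n x, continuous (H n) x).
Context (Hbound : forall n x, Rabs x <= 2 * R0 -> Cmod (H n x) <= K).
Context (Hlip : forall n x y, Rabs x <= 2 * R0 -> Rabs y <= 2 * R0 ->
  Cmod (H n x - H n y) <= K * Rabs (x - y)).
Context (csupp : forall j x, R0 < Rabs x -> c j x = RtoC 0).
Context (cbound : forall j x, Cmod (c j x) <= W * zweight j).
Context (clip : forall j x y, Cmod (c j x - c j y) <= W * zweight j * Rabs (x - y)).

(* With [H = H_n], [c = f_j] and [G = 2 gamma], [hop] is the operator T. *)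
Definition hterm (A : Z -> R -> C) (m : Z) (x : R) (n : Z) : C :=
  (G * conv R0 (H n) (A n) x * c (m - n)%Z x)%C.

Definition hop_lim (A : Z -> R -> C) (m : Z) (x : R) (l : C) : Prop :=
  filterlim (fun N => zsum N (hterm A m x)) eventually (locally l).

(** A total function chosen by epsilon; its value is the limit of the symmetric sums whenever [A] is
    in [inX], by [hop_spec]. *)
Definition hop (A : Z -> R -> C) (m : Z) (x : R) : C :=
  epsilon (inhabits (RtoC 0)) (hop_lim A m x).

(** The window has length [2 * R0], the kernel is at most [K], the coefficients contribute [W], and
    the weights sum to at most 2. A single term of the sum thus carries [hop_norm / 2]. *)
Definition hop_norm : R := 4 * R0 * K * W * Cmod G.

Lemma hop_norm_nonneg : 0 <= hop_norm.
Proof. unfold hop_norm. pose proof (Cmod_ge_0 G). repeat apply Rmult_le_pos; lra. Qed.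

Lemma W_zweight_nonneg (j : Z) : 0 <= W * zweight j.
Proof. eapply Rle_trans; [apply Cmod_ge_0|apply (cbound j 0)]. Qed.

Lemma shift_bound (x t : R) : Rabs x <= R0 -> - R0 <= t <= R0 -> Rabs (x - t) <= 2 * R0.
Proof. intros Hx Ht. apply Rabs_le_between in Hx. apply Rabs_le. lra. Qed.

Lemma conv_diff (n : Z) (a b : R -> C) (M x : R) :
  (forall t, continuous a t) -> (forall t, continuous b t) ->
  (forall t, Cmod (a t - b t) <= M) -> Rabs x <= R0 ->
  Cmod (conv R0 (H n) a x - conv R0 (H n) b x) <= 2 * R0 * (K * M).
Proof.
  intros Ha Hb HM Hx.
  replace (2 * R0) with (R0 - - R0) by ring. unfold conv.
  apply Cmod_CInt_minus_le; [lra| | |].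
  - now apply conv_integrand_continuous.
  - now apply conv_integrand_continuous.
  - intros t Ht.
    replace (H n (x - t)%R * a t - H n (x - t)%R * b t)%C with (H n (x - t)%R * (a t - b t))%C by ring.
    rewrite Cmod_mult.
    apply Rmult_le_compat; try apply Cmod_ge_0; [|apply HM].
    apply Hbound. now apply shift_bound.
Qed.

Lemma conv_0 (n : Z) (x : R) : conv R0 (H n) (fun _ => RtoC 0) x = RtoC 0.
Proof.
  apply CInt_0. intro t. apply Cmult_0_r.
Qed.

Lemma conv_bound (n : Z) (a : R -> C) (M x : R) :
  (forall t, continuous a t) -> (forall t, Cmod (a t) <= M) -> Rabs x <= R0 ->
  Cmod (conv R0 (H n) a x) <= 2 * R0 * (K * M).
Proof.
  intros Ha HM Hx.
  (* By linearity, the size estimate is the difference estimate against 0; [hterm_bound] reuses this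
     device. *)
  replace (conv R0 (H n) a x) with (conv R0 (H n) a x - conv R0 (H n) (fun _ => RtoC 0) x)%C
    by (rewrite conv_0; ring).
  apply conv_diff; auto.
  - intro t. apply continuous_const.
  - intro t. replace (a t - 0)%C with (a t) by ring. apply HM.
Qed.

Lemma conv_lip (n : Z) (a : R -> C) (M x y : R) :
  (forall t, continuous a t) -> (forall t, Cmod (a t) <= M) -> Rabs x <= R0 -> Rabs y <= R0 ->
  Cmod (conv R0 (H n) a x - conv R0 (H n) a y) <= 2 * R0 * (K * Rabs (x - y) * M).
Proof.
  intros Ha HM Hx Hy.
  replace (2 * R0) with (R0 - - R0) by ring. unfold conv.
  apply Cmod_CInt_minus_le; [lra| | |].
  - now apply conv_integrand_continuous.
  - now apply conv_integrand_continuous.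
  - intros t Ht.
    replace (H n (x - t)%R * a t - H n (y - t)%R * a t)%C
      with ((H n (x - t)%R - H n (y - t)%R) * a t)%C by ring.
    rewrite Cmod_mult.
    apply Rmult_le_compat; try apply Cmod_ge_0; [|apply HM].
    replace (x - y) with ((x - t) - (y - t)) by ring.
    apply Hlip; now apply shift_bound.
Qed.

Lemma hterm_diff (A B : Z -> R -> C) (M : R) (m : Z) (x : R) (n : Z) :
  inX R0 A -> inX R0 B -> (forall n t, Cmod (A n t - B n t) <= M) ->
  Cmod (hterm A m x n - hterm B m x n) <= hop_norm / 2 * M * zweight (m - n).
Proof.
  intros [HA _] [HB _] HM. unfold hterm.
  assert (HM0 : 0 <= M) by (eapply Rle_trans; [apply Cmod_ge_0|apply (HM 0%Z 0)]).
  pose proof (W_zweight_nonneg (m - n)) as Hw. pose proof (Cmod_ge_0 G).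
  match goal with |- Cmod ?z <= _ => replace z with
    (G * (conv R0 (H n) (A n) x - conv R0 (H n) (B n) x) * c (m - n)%Z x)%C by ring end.
  rewrite !Cmod_mult.
  replace (hop_norm / 2 * M * zweight (m - n))
    with (Cmod G * (2 * R0 * (K * M)) * (W * zweight (m - n))) by (unfold hop_norm; field).
  (* Outside the window the factor [c] vanishes, so the kernel is never evaluated beyond
     [2 * R0]. *)
  destruct (Rle_lt_dec (Rabs x) R0) as [Hx|Hx].
  - apply Rmult_le_compat; [|apply Cmod_ge_0| |apply cbound].
    + apply Rmult_le_pos; apply Cmod_ge_0.
    + apply Rmult_le_compat_l; [apply Cmod_ge_0|]. now apply conv_diff.
  - rewrite (csupp _ x Hx), Cmod_0, Rmult_0_r.
    apply Rmult_le_pos; [|exact Hw]. repeat apply Rmult_le_pos; lra.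
Qed.

Lemma hterm_bound (A : Z -> R -> C) (M : R) (m : Z) (x : R) (n : Z) :
  inX R0 A -> (forall n t, Cmod (A n t) <= M) ->
  Cmod (hterm A m x n) <= hop_norm / 2 * M * zweight (m - n).
Proof.
  intros HA HM.
  replace (hterm A m x n) with (hterm A m x n - hterm (fun _ _ => RtoC 0) m x n)%C.
  - apply hterm_diff; [exact HA| |].
    + split; [intros; apply continuous_const|]. split; [reflexivity|].
      exists 0. intros. rewrite Cmod_0. apply Rle_refl.
    + intros k t. replace (A k t - 0)%C with (A k t) by ring. apply HM.
  - unfold hterm. rewrite conv_0. ring.
Qed.

(** Product rule: the variation of [c] and that of the convolution contribute equally, which doubles
    the factor [hop_norm / 2]. *)
Lemma hterm_lip (A : Z -> R -> C) (M : R) (m : Z) (x y : R) (n : Z) :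
  inX R0 A -> (forall n t, Cmod (A n t) <= M) ->
  Cmod (hterm A m x n - hterm A m y n) <= hop_norm * M * Rabs (x - y) * zweight (m - n).
Proof.
  intros [HA _] HM.
  assert (HM0 : 0 <= M) by (eapply Rle_trans; [apply Cmod_ge_0|apply (HM 0%Z 0)]).
  pose proof (W_zweight_nonneg (m - n)) as Hw. pose proof (Cmod_ge_0 G) as HG.
  (* Only the first point has to lie in the window, so this also settles the cases where the other
     point lies outside and [c] vanishes there. *)
  assert (Hin : forall x y, Rabs x <= R0 ->
    Cmod (G * conv R0 (H n) (A n) x * (c (m - n)%Z x - c (m - n)%Z y))
      <= Cmod G * (2 * R0 * (K * M)) * (W * zweight (m - n) * Rabs (x - y))).
  { intros x' y' Hx'. rewrite !Cmod_mult.
    apply Rmult_le_compat; [|apply Cmod_ge_0| |apply clip].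
    + apply Rmult_le_pos; apply Cmod_ge_0.
    + apply Rmult_le_compat_l; [apply Cmod_ge_0|]. now apply conv_bound. }
  assert (Hpos : 0 <= Cmod G * (2 * R0 * (K * M)) * (W * zweight (m - n) * Rabs (x - y))).
  { apply Rmult_le_pos; [repeat apply Rmult_le_pos; lra|].
    apply Rmult_le_pos; [exact Hw|apply Rabs_pos]. }
  replace (hop_norm * M * Rabs (x - y) * zweight (m - n))
    with (2 * (Cmod G * (2 * R0 * (K * M)) * (W * zweight (m - n) * Rabs (x - y))))
    by (unfold hop_norm; ring).
  unfold hterm.
  destruct (Rle_lt_dec (Rabs x) R0) as [Hx|Hx]; destruct (Rle_lt_dec (Rabs y) R0) as [Hy|Hy].
  - match goal with |- Cmod ?z <= _ => replace z with
      (G * conv R0 (H n) (A n) x * (c (m - n)%Z x - c (m - n)%Z y)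
       + G * (conv R0 (H n) (A n) x - conv R0 (H n) (A n) y) * c (m - n)%Z y)%C by ring end.
    eapply Rle_trans; [apply Cmod_triangle|].
    specialize (Hin x y Hx).
    assert (H2 : Cmod (G * (conv R0 (H n) (A n) x - conv R0 (H n) (A n) y) * c (m - n)%Z y)
      <= Cmod G * (2 * R0 * (K * Rabs (x - y) * M)) * (W * zweight (m - n))).
    { rewrite !Cmod_mult.
      apply Rmult_le_compat; [|apply Cmod_ge_0| |apply cbound].
      + apply Rmult_le_pos; apply Cmod_ge_0.
      + apply Rmult_le_compat_l; [apply Cmod_ge_0|]. now apply conv_lip. }
    lra.
  - specialize (Hin x y Hx). rewrite (csupp _ y Hy) in *.
    match goal with |- Cmod ?z <= _ => replace z with
      (G * conv R0 (H n) (A n) x * (c (m - n)%Z x - 0))%C by ring end.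
    lra.
  - specialize (Hin y x Hy). rewrite (csupp _ x Hx) in *.
    rewrite (Rabs_minus_sym y x) in Hin.
    match goal with |- Cmod ?z <= _ => replace z with
      (G * conv R0 (H n) (A n) y * (c (m - n)%Z y - 0) * (- (1)))%C by ring end.
    rewrite Cmod_mult, Cmod_opp, Cmod_1. lra.
  - rewrite (csupp _ x Hx), (csupp _ y Hy).
    match goal with |- Cmod ?z <= _ => replace z with (RtoC 0) by ring end.
    rewrite Cmod_0. lra.
Qed.

Lemma zsumR_scaled_zweight (k : R) (m : Z) (N : nat) :
  0 <= k -> zsumR N (fun n => k * zweight (m - n)) <= 2 * k.
Proof.
  intro Hk. rewrite zsumR_scal. pose proof (zsumR_zweight m N). nra.
Qed.

Lemma hop_spec (A : Z -> R -> C) (m : Z) (x : R) : inX R0 A -> hop_lim A m x (hop A m x).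
Proof.
  intro HA. destruct HA as [HA1 [HA2 [M HM]]].
  assert (HM0 : 0 <= M) by (eapply Rle_trans; [apply Cmod_ge_0|apply (HM 0%Z 0)]).
  assert (HA : inX R0 A) by (split; [exact HA1|split; [exact HA2|now exists M]]).
  unfold hop. apply epsilon_spec.
  apply (zsum_dominated_cv _ (fun n => hop_norm / 2 * M * zweight (m - n)) (2 * (hop_norm / 2 * M))).
  - intro n. now apply hterm_bound.
  - intro N. apply zsumR_scaled_zweight. pose proof hop_norm_nonneg. apply Rmult_le_pos; lra.
Qed.

Lemma hop_unique (A : Z -> R -> C) (m : Z) (x : R) (l : C) :
  inX R0 A -> hop_lim A m x l -> l = hop A m x.
Proof.
  intros HA Hl. apply (Ccv_unique _ _ _ Hl). now apply hop_spec.
Qed.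

Lemma hop_diff (A B : Z -> R -> C) (M : R) (m : Z) (x : R) :
  inX R0 A -> inX R0 B -> (forall n t, Cmod (A n t - B n t) <= M) ->
  Cmod (hop A m x - hop B m x) <= hop_norm * M.
Proof.
  intros HA HB HM.
  assert (HM0 : 0 <= M) by (eapply Rle_trans; [apply Cmod_ge_0|apply (HM 0%Z 0)]).
  apply (Ccv_bound _ _ _ (Ccv_minus _ _ _ _ (hop_spec A m x HA) (hop_spec B m x HB))).
  intro N. rewrite <- zsum_minus.
  eapply Rle_trans; [apply zsum_le; intro n; now apply hterm_diff|].
  eapply Rle_trans; [apply zsumR_scaled_zweight|].
  - pose proof hop_norm_nonneg. apply Rmult_le_pos; lra.
  - lra.
Qed.

Lemma hop_bound (A : Z -> R -> C) (M : R) (m : Z) (x : R) :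
  inX R0 A -> (forall n t, Cmod (A n t) <= M) -> Cmod (hop A m x) <= hop_norm * M.
Proof.
  intros HA HM.
  assert (HM0 : 0 <= M) by (eapply Rle_trans; [apply Cmod_ge_0|apply (HM 0%Z 0)]).
  apply (Ccv_bound _ _ _ (hop_spec A m x HA)).
  intro N.
  eapply Rle_trans; [apply zsum_le; intro n; now apply hterm_bound|].
  eapply Rle_trans; [apply zsumR_scaled_zweight|].
  - pose proof hop_norm_nonneg. apply Rmult_le_pos; lra.
  - lra.
Qed.

Lemma hop_lip (A : Z -> R -> C) (M : R) (m : Z) (x y : R) :
  inX R0 A -> (forall n t, Cmod (A n t) <= M) ->
  Cmod (hop A m x - hop A m y) <= 2 * hop_norm * M * Rabs (x - y).
Proof.
  intros HA HM.
  assert (HM0 : 0 <= M) by (eapply Rle_trans; [apply Cmod_ge_0|apply (HM 0%Z 0)]).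
  apply (Ccv_bound _ _ _ (Ccv_minus _ _ _ _ (hop_spec A m x HA) (hop_spec A m y HA))).
  intro N. rewrite <- zsum_minus.
  eapply Rle_trans; [apply zsum_le; intro n; now apply hterm_lip|].
  eapply Rle_trans; [apply zsumR_scaled_zweight|].
  - pose proof hop_norm_nonneg. pose proof (Rabs_pos (x - y)).
    apply Rmult_le_pos; [apply Rmult_le_pos|]; assumption.
  - lra.
Qed.

Lemma hop_supp (A : Z -> R -> C) (m : Z) (x : R) :
  inX R0 A -> R0 < Rabs x -> hop A m x = RtoC 0.
Proof.
  intros HA Hx. symmetry. apply hop_unique; [exact HA|].
  apply Ccv_Cmod. intro eps. exists 0%nat. intros N _.
  apply Rle_lt_trans with 0; [|apply cond_pos].
  replace (zsum N (hterm A m x) - 0)%C with (zsum N (hterm A m x)) by ring.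
  (* The weight is written [0 * 0] so that [zsumR_scal] evaluates its sum. *)
  eapply Rle_trans; [apply (zsum_le _ (fun _ => 0 * 0))|].
  - intro n. unfold hterm. rewrite (csupp _ _ Hx), Cmult_0_r, Cmod_0. lra.
  - rewrite (zsumR_scal 0 (fun _ => 0)). lra.
Qed.

Lemma inX_affine_hop (eps : R) (g A : Z -> R -> C) :
  inX R0 g -> inX R0 A -> inX R0 (fun m x => g m x + RtoC eps * hop A m x)%C.
Proof.
  intros [Hg1 [Hg2 [Mg HMg]]] HA. pose proof HA as [_ [_ [M HM]]].
  split; [|split].
  - intros m x.
    apply (continuous_ext (fun t => g m t - RtoC (- eps) * hop A m t)%C).
    { intro t. rewrite RtoC_opp. apply injective_projections; simpl; ring. }
    apply continuous_Cminus; [apply Hg1|].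
    apply continuous_Cmult; [apply continuous_const|].
    apply continuous_C_lipschitz with (L := 2 * hop_norm * M). intro y. now apply hop_lip.
  - intros m x Hx. rewrite Hg2, hop_supp by assumption. ring.
  - exists (Mg + Rabs eps * (hop_norm * M)). intros m x.
    eapply Rle_trans; [apply Cmod_triangle|]. apply Rplus_le_compat; [apply HMg|].
    rewrite Cmod_mult, Cmod_R. apply Rmult_le_compat_l; [apply Rabs_pos|].
    now apply hop_bound.
Qed.

(** The closedness hypothesis of [contraction_fixpoint] for [inX]; continuity is the usual [eps / 3]
    argument. *)
Lemma inX_uniform_limit (A : Z -> R -> C) :
  (forall delta : posreal, exists B, inX R0 B /\ forall n x, Cmod (A n x - B n x) <= delta) ->
  inX R0 A.
Proof.
  intro Happ. split; [|split].
  - intros n x. apply continuous_Cmod. intro eps.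
    assert (He : 0 < eps / 3) by (pose proof (cond_pos eps); lra).
    destruct (Happ (mkposreal _ He)) as [B [[HB _] HAB]]. simpl in HAB.
    destruct (proj1 (continuous_Cmod _ _) (HB n x) (mkposreal _ He)) as [delta Hd].
    exists delta. intros y Hy. specialize (Hd y Hy). simpl in Hd.
    replace (A n y - A n x)%C
      with ((A n y - B n y) + ((B n y - B n x) + - (A n x - B n x)))%C by ring.
    eapply Rle_lt_trans; [apply Cmod_triangle|].
    pose proof (Cmod_triangle (B n y - B n x) (- (A n x - B n x))) as Ht.
    rewrite Cmod_opp in Ht. pose proof (HAB n x). pose proof (HAB n y). lra.
  - intros n x Hx. apply Cmod_eq_0. apply Rle_antisym; [|apply Cmod_ge_0].
    apply le_epsilon. intros e He.
    destruct (Happ (mkposreal _ He)) as [B [[_ [HB _]] HAB]]. simpl in HAB.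
    specialize (HAB n x). rewrite (HB n x Hx) in HAB.
    replace (A n x - 0)%C with (A n x) in HAB by ring. lra.
  - destruct (Happ (mkposreal 1 Rlt_0_1)) as [B [[_ [_ [M HM]]] HAB]]. simpl in HAB.
    exists (1 + M). intros n x. replace (A n x) with ((A n x - B n x) + B n x)%C by ring.
    eapply Rle_trans; [apply Cmod_triangle|]. specialize (HM n x). specialize (HAB n x). lra.
Qed.

(** The threshold [1 / 2] makes [1 / (1 - q)] at most 2, the factor in the error bound. Uniqueness
    is part of the conclusion because [resolvent] selects only a unique solution. *)
Lemma affine_hop_fixpoint (eps Mg : R) (g : Z -> R -> C) :
  Rabs eps * hop_norm <= 1 / 2 -> inX R0 g -> (forall n x, Cmod (g n x) <= Mg) ->
  exists A, inX R0 A /\ (forall m x, A m x = g m x + RtoC eps * hop A m x)%C /\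
    (forall m x, Cmod (A m x - g m x) <= 2 * (Rabs eps * hop_norm) * Mg) /\
    forall A', inX R0 A' -> (forall m x, A' m x = g m x + RtoC eps * hop A' m x)%C -> A' = A.
Proof.
  intros Hq Hg HMg.
  assert (HMg0 : 0 <= Mg) by (eapply Rle_trans; [apply Cmod_ge_0|apply (HMg 0%Z 0)]).
  set (q := Rabs eps * hop_norm) in *.
  assert (Hq0 : 0 <= q) by (apply Rmult_le_pos; [apply Rabs_pos|apply hop_norm_nonneg]).
  set (Phi := fun (A : Z -> R -> C) m x => (g m x + RtoC eps * hop A m x)%C).
  assert (Hcontr : forall A B M, inX R0 A -> inX R0 B ->
    (forall i j, Cmod (A i j - B i j) <= M) -> forall i j, Cmod (Phi A i j - Phi B i j) <= q * M).
  { intros A B M HA HB HM m x. unfold Phi.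
    match goal with |- Cmod ?z <= _ =>
      replace z with (RtoC eps * (hop A m x - hop B m x))%C by ring end.
    rewrite Cmod_mult, Cmod_R. unfold q. rewrite Rmult_assoc.
    apply Rmult_le_compat_l; [apply Rabs_pos|]. now apply hop_diff. }
  destruct (contraction_fixpoint (inX R0) Phi q (q * Mg) g) as [A [HA [Hfix HAg]]].
  - lra.
  - intros A HA. now apply inX_affine_hop.
  - exact Hcontr.
  - apply inX_uniform_limit.
  - exact Hg.
  - intros m x. unfold Phi. replace (g m x + RtoC eps * hop g m x - g m x)%C
      with (RtoC eps * hop g m x)%C by ring.
    rewrite Cmod_mult, Cmod_R. unfold q. rewrite Rmult_assoc.
    apply Rmult_le_compat_l; [apply Rabs_pos|]. now apply hop_bound.
  - exists A. split; [exact HA|]. split; [|split].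
    + intros m x. symmetry. apply Hfix.
    + intros m x. eapply Rle_trans; [apply HAg|]. apply Rle_div_l; [lra|].
      assert (0 <= q * Mg) by now apply Rmult_le_pos. nra.
    + intros A' HA' Hfix'.
      (* Both solutions are bounded, so their difference has a finite bound [M], which repeated
         contraction shrinks to 0. *)
      assert (Hb : exists M, forall i j, Cmod (A' i j - A i j) <= M).
      { destruct HA as [_ [_ [M HM]]]. destruct HA' as [_ [_ [M' HM']]].
        exists (M' + M). intros i j. unfold Cminus.
        eapply Rle_trans; [apply Cmod_triangle|]. rewrite Cmod_opp.
        specialize (HM i j). specialize (HM' i j). lra. }
      destruct Hb as [M HM].
      assert (HMn : forall k i j, Cmod (A' i j - A i j) <= (1 / 2) ^ k * M).
      { induction k as [|k IH]; intros i j; [simpl; rewrite Rmult_1_l; apply HM|].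
        pose proof (Hcontr A' A _ HA' HA IH i j) as Hk.
        rewrite Hfix in Hk. replace (Phi A' i j) with (A' i j) in Hk by apply Hfix'.
        eapply Rle_trans; [exact Hk|]. simpl pow. rewrite Rmult_assoc.
        apply Rmult_le_compat_r; [|exact Hq].
        eapply Rle_trans; [apply Cmod_ge_0|apply (IH i j)]. }
      apply functional_extensionality. intro i. apply functional_extensionality. intro j.
      assert (Hz : Cmod (A' i j - A i j) <= 0).
      { assert (HL : is_lim_seq (fun k => (1 / 2) ^ k * M) 0).
        { replace (Finite 0) with (Rbar_mult 0 M) by (simpl; f_equal; ring).
          apply is_lim_seq_scal_r. apply is_lim_seq_geom. rewrite Rabs_pos_eq; lra. }
        exact (is_lim_seq_le (fun _ => Cmod (A' i j - A i j)) _ _ _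
                 (fun k => HMn k i j) (is_lim_seq_const _) HL). }
      pose proof (Cmod_ge_0 (A' i j - A i j)).
      assert (Hm : (A' i j - A i j = 0)%C) by (apply Cmod_eq_0; lra).
      replace (A' i j) with ((A' i j - A i j) + A i j)%C by ring.
      rewrite Hm. ring.
Qed.

End Operator.

(** * Decay of the Fourier coefficients *)

(** Compactness by way of uniform continuity: walk along the segment from [(a, c)] to [(x, y)] in
    [N] steps shorter than [delta]; each step changes [F] by less than 1. *)
Lemma continuous_bounded_2d (F : R -> R -> R) (a b c d : R) :
  a <= b -> c <= d ->
  (forall p : R * R, continuous (fun q : R * R => F (fst q) (snd q)) p) ->
  exists M, forall x y, a <= x <= b -> c <= y <= d -> Rabs (F x y) <= M.
Proof.
  intros Hab Hcd HF.
  destruct (uniform_continuity_2d F a b c d) with (eps := mkposreal 1 Rlt_0_1) as [delta Hd].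
  { intros x y _ _. apply continuity_2d_pt_filterlim. exact (HF (x, y)). }
  simpl in Hd.
  set (L := Rmax (b - a) (d - c)).
  assert (HL : 0 <= L) by (apply Rle_trans with (b - a); [lra|apply Rmax_l]).
  destruct (nfloor_ex (L / delta)) as [n [_ Hn]].
  { apply Rmult_le_pos; [exact HL|left; apply Rinv_0_lt_compat, cond_pos]. }
  rewrite <- S_INR in Hn. set (N := S n) in *.
  assert (HN : 0 < INR N) by (apply lt_0_INR; unfold N; lia).
  assert (Hstep : L / INR N < delta).
  { apply Rlt_div_l in Hn; [|apply cond_pos]. apply Rlt_div_l; [exact HN|]. lra. }
  exists (Rabs (F a c) + INR N). intros x y Hx Hy.
  assert (Hk : forall k, (k <= N)%nat ->
    Rabs (F (a + INR k / INR N * (x - a)) (c + INR k / INR N * (y - c))) <= Rabs (F a c) + INR k).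
  { induction k as [|k IH]; intro HkN.
    - change (INR 0) with 0.
      replace (a + 0 / INR N * (x - a)) with a by (field; lra).
      replace (c + 0 / INR N * (y - c)) with c by (field; lra). lra.
    - specialize (IH ltac:(lia)).
      assert (Hr : forall i, (i <= N)%nat -> 0 <= INR i / INR N <= 1).
      { intros i Hi. apply le_INR in Hi. pose proof (pos_INR i).
        split; [apply Rmult_le_pos; [lra|left; now apply Rinv_0_lt_compat]|].
        apply Rle_div_l; lra. }
      pose proof (Hr k ltac:(lia)) as H1. pose proof (Hr (S k) HkN) as H2.
      assert (Heq : INR (S k) / INR N = INR k / INR N + / INR N) by (rewrite S_INR; field; lra).
      assert (Hi : 0 < / INR N) by now apply Rinv_0_lt_compat.
      pose proof (Rmax_l (b - a) (d - c)) as HL1. pose proof (Rmax_r (b - a) (d - c)) as HL2.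
      fold L in HL1, HL2. unfold Rdiv in Hstep.
      set (s := INR k / INR N) in *. set (s' := INR (S k) / INR N) in *.
      assert (Hd1 : Rabs (F (a + s' * (x - a)) (c + s' * (y - c))
                          - F (a + s * (x - a)) (c + s * (y - c))) < 1).
      { apply Hd; try nra.
        - replace (a + s' * (x - a) - (a + s * (x - a))) with (/ INR N * (x - a))
            by (rewrite Heq; ring).
          rewrite Rabs_pos_eq by nra. nra.
        - replace (c + s' * (y - c) - (c + s * (y - c))) with (/ INR N * (y - c))
            by (rewrite Heq; ring).
          rewrite Rabs_pos_eq by nra. nra. }
      rewrite S_INR.
      pose proof (Rabs_triang (F (a + s' * (x - a)) (c + s' * (y - c))
                          - F (a + s * (x - a)) (c + s * (y - c)))
                   (F (a + s * (x - a)) (c + s * (y - c)))) as Ht.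
      replace (F (a + s' * (x - a)) (c + s' * (y - c))
                          - F (a + s * (x - a)) (c + s * (y - c)) +
                   (F (a + s * (x - a)) (c + s * (y - c))))
        with (F (a + s' * (x - a)) (c + s' * (y - c))) in Ht by ring.
      lra. }
  specialize (Hk N (le_n N)).
  replace (a + INR N / INR N * (x - a)) with x in Hk by (field; lra).
  replace (c + INR N / INR N * (y - c)) with y in Hk by (field; lra).
  exact Hk.
Qed.

Lemma sin_2PI_IZR (j : Z) : sin (IZR j * (2 * PI)) = 0.
Proof.
  apply sin_eq_0_1. exists (j * 2)%Z. rewrite mult_IZR. ring.
Qed.

Lemma cos_2PI_IZR (j : Z) : cos (IZR j * (2 * PI)) = 1.
Proof.
  replace (IZR j * (2 * PI)) with (2 * (IZR j * PI)) by ring.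
  rewrite cos_2a_sin, sin_eq_0_1 by now exists j. ring.
Qed.

(** [G] is an antiderivative of [g + c * k] with equal end values, so the integral of [g] is [- c]
    times that of [k]. Two integrations by parts thus reduce to checking one derivative. *)
Lemma RInt_parts_zero (G g k : R -> R) (b M c : R) :
  0 <= b -> (forall y, is_derive G y (g y + c * k y)) ->
  (forall y, continuous g y) -> (forall y, continuous k y) ->
  G b = G 0 -> (forall y, 0 <= y <= b -> Rabs (k y) <= M) ->
  Rabs (RInt g 0 b) <= Rabs c * (b * M).
Proof.
  intros Hb HG Hg Hk HGb HM.
  assert (Eg : ex_RInt g 0 b) by (apply (ex_RInt_continuous (V := R_CompleteNormedModule)); auto).
  assert (Ek : ex_RInt k 0 b) by (apply (ex_RInt_continuous (V := R_CompleteNormedModule)); auto).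
  assert (H1 : is_RInt (fun y => g y + c * k y) 0 b (minus (G b) (G 0))).
  { apply (is_RInt_derive (V := R_CompleteNormedModule)).
    - intros y _. apply HG.
    - intros y _. apply (continuous_plus (V := R_NormedModule)); [apply Hg|].
      apply (continuous_scal_r (V := R_NormedModule)), Hk. }
  assert (H2 : is_RInt (fun y => g y + c * k y) 0 b (plus (RInt g 0 b) (scal c (RInt k 0 b)))).
  { apply (is_RInt_plus (V := R_NormedModule)); [now apply (RInt_correct (V := R_CompleteNormedModule))|].
    apply (is_RInt_scal (V := R_NormedModule)). now apply (RInt_correct (V := R_CompleteNormedModule)). }
  apply (is_RInt_unique (V := R_CompleteNormedModule)) in H1.
  apply (is_RInt_unique (V := R_CompleteNormedModule)) in H2. rewrite H1 in H2. rewrite HGb in H2.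
  unfold minus, plus, opp, scal in H2. simpl in H2. unfold mult in H2. simpl in H2.
  replace (RInt g 0 b) with (- (c * RInt k 0 b)) by lra.
  rewrite Rabs_Ropp, Rabs_mult. apply Rmult_le_compat_l; [apply Rabs_pos|].
  replace (b * M) with ((b - 0) * M) by ring.
  now apply abs_RInt_le_const.
Qed.

Lemma fourier_integrand_continuous (h : R -> R) (a : R) :
  (forall y, continuous h y) ->
  forall s, continuous (fun y => (cexpi (a * y) * RtoC (h y))%C) s.
Proof.
  intros Hh s. apply continuous_Cmult; [|now apply continuous_RtoC].
  apply continuous_cexpi, (continuous_scal_r (V := R_NormedModule)), continuous_id.
Qed.

(* Two integrations by parts; [zweight 0 = 1/2] accounts for the case [j = 0]. *)
Lemma fourier_decay (h h1 h2 : R -> R) (M : R) (j : Z) :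
  (forall y, is_derive h y (h1 y)) -> (forall y, is_derive h1 y (h2 y)) ->
  (forall y, continuous h2 y) -> h (2 * PI) = h 0 -> h1 (2 * PI) = h1 0 ->
  (forall y, 0 <= y <= 2 * PI -> Rabs (h y) <= M) ->
  (forall y, 0 <= y <= 2 * PI -> Rabs (h2 y) <= M) ->
  Cmod (CInt (fun y => (cexpi (- IZR j * y) * RtoC (h y))%C) 0 (2 * PI))
    <= 24 * PI * M * zweight j.
Proof.
  intros Hh Hh1 Ch2 Ph Ph1 Mh Mh2. pose proof PI_RGT_0 as HPI.
  assert (HM : 0 <= M) by (eapply Rle_trans; [apply Rabs_pos|apply (Mh 0); lra]).
  assert (Ch : forall y, continuous h y)
    by (intro y; apply (ex_derive_continuous h); eexists; apply Hh).
  destruct (zweight_lower j) as [Hj|[-> ->]].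
  - assert (Hj0 : IZR j <> 0) by (intro E; rewrite E in Hj; lra).
    set (a := - IZR j) in *. assert (Ha : a <> 0) by (unfold a; lra).
    rewrite CInt_pair by now apply fourier_integrand_continuous.
    eapply Rle_trans; [apply Cmod_le_sum|]. simpl fst. simpl snd.
    assert (Hsin : sin (a * (2 * PI)) = 0) by (unfold a; rewrite <- opp_IZR; apply sin_2PI_IZR).
    assert (Hcos : cos (a * (2 * PI)) = 1) by (unfold a; rewrite <- opp_IZR; apply cos_2PI_IZR).
    assert (Htrig : forall (g : R -> R), (forall y, continuous g y) -> (forall y, Rabs (g y) <= 1) ->
      (forall y, continuous (fun y => g y * h2 y) y) /\
      (forall y, 0 <= y <= 2 * PI -> Rabs (g y * h2 y) <= M) /\
      (forall y, continuous (fun y => g y * h y) y)).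
    { intros g Cg Bg. split; [|split].
      - intro y. now apply (continuous_mult (K := R_AbsRing)).
      - intros y Hy. rewrite Rabs_mult. specialize (Mh2 y Hy). specialize (Bg y).
        pose proof (Rabs_pos (g y)). pose proof (Rabs_pos (h2 y)). nra.
      - intro y. now apply (continuous_mult (K := R_AbsRing)). }
    assert (Clin : forall y, continuous (fun y => a * y) y).
    { intro y. apply (continuous_scal_r (V := R_NormedModule)), continuous_id. }
    destruct (Htrig (fun y => cos (a * y))) as [C1 [C2 C3]].
    { intro y. now apply continuous_cos_comp. }
    { intro y. apply Rabs_le, COS_bound. }
    destruct (Htrig (fun y => sin (a * y))) as [S1 [S2 S3]].
    { intro y. now apply continuous_sin_comp. }
    { intro y. apply Rabs_le, SIN_bound. }
    assert (H1 : Rabs (RInt (fun y => cos (a * y) * h y) 0 (2 * PI))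
      <= Rabs (/ a ^ 2) * (2 * PI * M)).
    { apply RInt_parts_zero with (k := fun y => cos (a * y) * h2 y)
        (G := fun y => h y * sin (a * y) / a + h1 y * cos (a * y) / a ^ 2); auto; [lra| |].
      - intro y. pose proof (Hh y). pose proof (Hh1 y).
        auto_derive; [repeat split; eexists; eassumption|].
        change (Derive (fun x : R => h x) y) with (Derive h y).
        change (Derive (fun x : R => h1 x) y) with (Derive h1 y).
        rewrite (is_derive_unique h y _ (Hh y)), (is_derive_unique h1 y _ (Hh1 y)).
        field. exact Ha.
      - rewrite Hsin, Hcos, Ph, Ph1, (Rmult_0_r a), sin_0, cos_0. reflexivity. }
    assert (H2 : Rabs (RInt (fun y => sin (a * y) * h y) 0 (2 * PI))
      <= Rabs (/ a ^ 2) * (2 * PI * M)).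
    { apply RInt_parts_zero with (k := fun y => sin (a * y) * h2 y)
        (G := fun y => - h y * cos (a * y) / a + h1 y * sin (a * y) / a ^ 2); auto; [lra| |].
      - intro y. pose proof (Hh y). pose proof (Hh1 y).
        auto_derive; [repeat split; eexists; eassumption|].
        change (Derive (fun x : R => h x) y) with (Derive h y).
        change (Derive (fun x : R => h1 x) y) with (Derive h1 y).
        rewrite (is_derive_unique h y _ (Hh y)), (is_derive_unique h1 y _ (Hh1 y)).
        field. exact Ha.
      - rewrite Hsin, Hcos, Ph, Ph1, (Rmult_0_r a), sin_0, cos_0. reflexivity. }
    rewrite (RInt_ext _ (fun y => cos (a * y) * h y)) by (intros; simpl; ring).
    rewrite (RInt_ext (fun t => cos (a * t) * 0 + _) (fun y => sin (a * y) * h y)) by (intros; simpl; ring).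
    assert (Ha2 : 0 < a ^ 2) by (apply pow2_gt_0; exact Ha).
    rewrite (Rabs_pos_eq (/ a ^ 2)) in H1, H2 by (left; now apply Rinv_0_lt_compat).
    (* Each of the two components is then at most [12 * PI * M * zweight j], which yields the
       constant 24. *)
    assert (Hw : / a ^ 2 <= 6 * zweight j).
    { apply Rmult_le_reg_l with (a ^ 2); [exact Ha2|]. rewrite Rinv_r by lra.
      replace (a ^ 2) with (IZR j ^ 2) by (unfold a; ring). lra. }
    assert (/ a ^ 2 * (2 * PI * M) <= 6 * zweight j * (2 * PI * M)).
    { apply Rmult_le_compat_r; [|exact Hw]. apply Rmult_le_pos; lra. }
    lra.
  - eapply Rle_trans.
    + apply Cmod_CInt_le with (M := M); [lra|now apply fourier_integrand_continuous|].
      intros y Hy. rewrite Cmod_mult, Cmod_cexpi, Cmod_R, Rmult_1_l. now apply Mh.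
    + nra.
Qed.

(** The set [R0 < |x|] is open, so an x-derivative there differentiates a locally zero function; a
    y-derivative keeps [x] fixed. *)
Lemma iterD_support (f : R -> R -> R) (R0 : R) (w : list bool) :
  (forall x y, R0 < Rabs x -> f x y = 0) -> forall x y, R0 < Rabs x -> iterD w f x y = 0.
Proof.
  intro Hf. induction w as [|b w IH]; [exact Hf|].
  intros x y Hx. simpl. destruct b.
  - unfold Defs.Dx. rewrite <- (Derive_const 0 x). apply Derive_ext_loc.
    assert (He : 0 < Rabs x - R0) by lra.
    exists (mkposreal _ He). intros t Ht. apply IH.
    change (Rabs (t - x) < Rabs x - R0) in Ht.
    pose proof (Rabs_triang_inv x t : Rabs x - Rabs t <= Rabs (x - t)).
    rewrite Rabs_minus_sym in Ht. lra.
  - unfold Dy. rewrite <- (Derive_const 0 y). apply Derive_ext. intro t. now apply IH.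
Qed.

Lemma iterD_bounded (f : R -> R -> R) (R0 : R) (w : list bool) :
  smooth2 f -> (forall x y, R0 < Rabs x -> f x y = 0) ->
  exists M, 0 <= M /\ forall x y, 0 <= y <= 2 * PI -> Rabs (iterD w f x y) <= M.
Proof.
  intros Hs Hf. pose proof PI_RGT_0.
  (* [R0] carries no sign here; its absolute value keeps the rectangle nonempty. *)
  assert (Hle : - Rabs R0 <= Rabs R0) by (pose proof (Rabs_pos R0); lra).
  destruct (continuous_bounded_2d (iterD w f) (- Rabs R0) (Rabs R0) 0 (2 * PI) Hle ltac:(lra)
              (proj1 (Hs w))) as [M HM].
  exists (Rmax M 0). split; [apply Rmax_r|]. intros x y Hy.
  destruct (Rle_lt_dec (Rabs x) (Rabs R0)) as [Hx|Hx].
  - eapply Rle_trans; [|apply Rmax_l]. apply HM; [|exact Hy].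
    now apply Rabs_le_between.
  - rewrite (iterD_support f R0 w Hf), Rabs_R0; [apply Rmax_r|].
    pose proof (Rle_abs R0). lra.
Qed.

Lemma iterD_lipschitz (f : R -> R -> R) (R0 : R) (w : list bool) :
  smooth2 f -> (forall x y, R0 < Rabs x -> f x y = 0) ->
  exists M, 0 <= M /\ forall x x' y, 0 <= y <= 2 * PI ->
    Rabs (iterD w f x y - iterD w f x' y) <= M * Rabs (x - x').
Proof.
  intros Hs Hf. destruct (iterD_bounded f R0 (true :: w) Hs Hf) as [M [HM0 HM]].
  exists M. split; [exact HM0|]. intros x x' y Hy.
  apply (Rlipschitz_derive (fun t => iterD w f t y) (fun t => iterD (true :: w) f t y)).
  - intros t _. apply Derive_correct. exact (proj1 (proj2 (Hs w) t y)).
  - intros t _. now apply HM.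
Qed.

Lemma Dy_periodic (f : R -> R -> R) (T : R) :
  smooth2 f -> (forall x y, f x (y + T) = f x y) -> forall x y, Dy f x (y + T) = Dy f x y.
Proof.
  intros Hs Hp x y. unfold Dy.
  transitivity (Derive (fun t => f x (t + T)) y); [|apply Derive_ext; intro t; apply Hp].
  symmetry. apply is_derive_unique.
  evar_last.
  - apply (is_derive_comp (fun t => f x t) (fun t => t + T)).
    + apply Derive_correct. exact (proj2 (proj2 (Hs nil) x _)).
    + auto_derive; [exact I|reflexivity].
  - unfold scal. simpl. unfold mult. simpl. ring.
Qed.

Lemma smooth2_continuous_y (f : R -> R -> R) (w : list bool) (x y : R) :
  smooth2 f -> continuous (fun t => iterD w f x t) y.
Proof.
  intro Hs. apply (ex_derive_continuous (fun t => iterD w f x t)). exact (proj2 (proj2 (Hs w) x y)).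
Qed.

(** The Lipschitz bound is again [fourier_decay], applied to [f x - f x']: this difference and its
    second y-derivative are at most [M * |x - x'|], as the x-derivatives are bounded. *)
Lemma fj_decay (f : R -> R -> R) (R0 : R) :
  smooth2 f -> (forall x y, f x (y + 2 * PI) = f x y) -> (forall x y, R0 < Rabs x -> f x y = 0) ->
  exists W, 0 <= W /\
    (forall j x, Cmod (fj f j x) <= W * zweight j) /\
    (forall j x y, Cmod (fj f j x - fj f j y) <= W * zweight j * Rabs (x - y)).
Proof.
  intros Hs Hp Hf. pose proof PI_RGT_0 as HPI.
  pose (w2 := (false :: false :: nil)%list).
  destruct (iterD_bounded f R0 nil Hs Hf) as [M1 [P1 B1]].
  destruct (iterD_bounded f R0 w2 Hs Hf) as [M2 [P2 B2]].
  destruct (iterD_lipschitz f R0 nil Hs Hf) as [M3 [P3 B3]].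
  destruct (iterD_lipschitz f R0 w2 Hs Hf) as [M4 [P4 B4]].
  set (M := M1 + M2 + M3 + M4).
  assert (D1 : forall x y, is_derive (fun t => f x t) y (Dy f x y)).
  { intros x y. apply Derive_correct. exact (proj2 (proj2 (Hs nil) x y)). }
  assert (D2 : forall x y, is_derive (fun t => Dy f x t) y (iterD w2 f x y)).
  { intros x y. apply Derive_correct. exact (proj2 (proj2 (Hs (false :: nil)%list) x y)). }
  assert (Hp0 : forall x, f x (2 * PI) = f x 0) by (intro x; rewrite <- (Hp x 0); f_equal; ring).
  assert (Hp1 : forall x, Dy f x (2 * PI) = Dy f x 0).
  { intro x. rewrite <- (Dy_periodic f (2 * PI) Hs Hp x 0). f_equal. ring. }
  exists (24 * PI * M). split; [|split].
  - unfold M. apply Rmult_le_pos; lra.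
  - intros j x. unfold fj.
    apply fourier_decay with (h1 := Dy f x) (h2 := iterD w2 f x); auto.
    + intro y. now apply smooth2_continuous_y.
    + intros y Hy. specialize (B1 x y Hy). simpl in B1. unfold M. lra.
    + intros y Hy. specialize (B2 x y Hy). unfold M. lra.
  - intros j x x'. unfold fj.
    rewrite <- CInt_minus
      by (apply fourier_integrand_continuous; intro; now apply (smooth2_continuous_y f nil)).
    replace (24 * PI * M * zweight j * Rabs (x - x'))
      with (24 * PI * (M * Rabs (x - x')) * zweight j) by ring.
    replace (CInt _ 0 (2 * PI)) with
      (CInt (fun y => (cexpi (- IZR j * y) * RtoC (f x y - f x' y))%C) 0 (2 * PI)).
    2:{ apply (RInt_ext (V := C_R_CompleteNormedModule)). intros y _. rewrite RtoC_minus.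
        apply injective_projections; simpl; ring. }
    pose proof (Rabs_pos (x - x')) as Hx.
    assert (Hle : forall k, k <= M -> k * Rabs (x - x') <= M * Rabs (x - x'))
      by (intros; now apply Rmult_le_compat_r).
    apply fourier_decay with (h1 := fun y => Dy f x y - Dy f x' y)
      (h2 := fun y => iterD w2 f x y - iterD w2 f x' y).
    + intro y. apply (is_derive_minus (V := R_NormedModule)); apply D1.
    + intro y. apply (is_derive_minus (V := R_NormedModule)); apply D2.
    + intro y. apply (continuous_minus (V := R_NormedModule)); now apply smooth2_continuous_y.
    + now rewrite !Hp0.
    + now rewrite !Hp1.
    + intros y Hy. eapply Rle_trans; [exact (B3 x x' y Hy)|]. apply Hle. unfold M. lra.
    + intros y Hy. eapply Rle_trans; [exact (B4 x x' y Hy)|]. apply Hle. unfold M. lra.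
Qed.

Lemma fj_support (f : R -> R -> R) (R0 : R) (j : Z) (x : R) :
  (forall x y, R0 < Rabs x -> f x y = 0) -> R0 < Rabs x -> fj f j x = RtoC 0.
Proof.
  intros Hf Hx. apply CInt_0. intro t. rewrite (Hf x t Hx). apply Cmult_0_r.
Qed.

(** * Uniform bounds for the kernels *)

Lemma exp_le_mono (a b : R) : a <= b -> exp a <= exp b.
Proof. intros [H| ->]; [left; now apply exp_increasing|apply Rle_refl]. Qed.

(** One family for both real kernels: [c = 1] gives [H_{-1}] and [c = 0] the other modes.
    Differentiation cancels the factor [1 / k]. *)
Lemma exp_kernel_derive (k c u : R) :
  k <> 0 -> is_derive (fun u => (exp (- k * u) - c) / (2 * k)) u (- exp (- k * u) / 2).
Proof.
  intro Hk. auto_derive; [exact I|]. field. exact Hk.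
Qed.

(** The [Rmax] covers negative [k], where the exponential grows and is largest at [u = L]. *)
Lemma exp_kernel_lipschitz (k c L s t : R) :
  k <> 0 -> 0 <= s <= L -> 0 <= t <= L ->
  Rabs ((exp (- k * s) - c) / (2 * k) - (exp (- k * t) - c) / (2 * k))
    <= exp (Rmax (- k * L) 0) * Rabs (s - t).
Proof.
  intros Hk Hs Ht.
  apply (Rlipschitz_derive (fun u => (exp (- k * u) - c) / (2 * k)) (fun u => - exp (- k * u) / 2)).
  - intros u _. now apply exp_kernel_derive.
  - intros u Hu.
    assert (Hu' : 0 <= u <= L).
    { unfold Rmin, Rmax in Hu. destruct (Rle_dec t s); lra. }
    pose proof (exp_pos (- k * u)).
    assert (Hle : exp (- k * u) <= exp (Rmax (- k * L) 0)).
    { apply exp_le_mono. destruct (Rle_lt_dec 0 k).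
      - apply Rle_trans with 0; [nra|apply Rmax_r].
      - apply Rle_trans with (- k * L); [nra|apply Rmax_l]. }
    rewrite Rabs_div, Rabs_Ropp, !Rabs_pos_eq by lra. lra.
Qed.

(** The extreme modes are [n = 1], where the difference of squares equals [4 * beta], and [n = -2],
    where it is [3 - 2 * beta], larger since [beta < 1 / 2]. *)
Lemma km_lower (mu beta : R) (n : Z) :
  0 < beta < 1 / 2 -> n <> 0%Z -> n <> (-1)%Z -> sqrt (4 * beta) <= km mu beta n.
Proof.
  intros Hb H0 H1. unfold km. apply sqrt_le_1_alt.
  pose proof (pow2_ge_0 mu).
  enough (4 * beta <= (beta + IZR n) ^ 2 - (1 - beta) ^ 2) by lra.
  destruct (Z_lt_le_dec n 0) as [Hn|Hn].
  - assert (Hn2 : (n <= -2)%Z) by lia. apply IZR_le in Hn2. nra.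
  - assert (Hn2 : (1 <= n)%Z) by lia. apply IZR_le in Hn2. nra.
Qed.

(** The factor [3 / 4] leaves a quarter of [1 - 2 * beta] under the root. *)
Lemma k0_lower (mu beta : R) :
  0 < beta < 1 / 2 -> mu ^ 2 <= 3 / 4 * (1 - 2 * beta) -> sqrt (1 - 2 * beta) / 2 <= k0 mu beta.
Proof.
  intros Hb Hmu. unfold k0.
  replace (sqrt (1 - 2 * beta) / 2) with (sqrt ((1 - 2 * beta) / 4)).
  - apply sqrt_le_1_alt. lra.
  - rewrite sqrt_div_alt by lra. f_equal.
    replace 4 with (2 * 2) by ring. apply sqrt_square. lra.
Qed.

(** The squares differ by [mu ^ 2], and the sum of the two roots is at least
    [sqrt (1 - 2 * beta)]. *)
Lemma k0_limit (mu beta : R) :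
  0 < beta < 1 / 2 -> mu ^ 2 <= 3 / 4 * (1 - 2 * beta) ->
  Rabs (k0 mu beta - sqrt (1 - 2 * beta)) <= mu ^ 2 / sqrt (1 - 2 * beta).
Proof.
  intros Hb Hmu. pose proof (k0_lower mu beta Hb Hmu) as Hk.
  assert (Hka : 0 < sqrt (1 - 2 * beta)) by (apply sqrt_lt_R0; lra).
  assert (E1 : k0 mu beta * k0 mu beta = 1 - 2 * beta - mu ^ 2).
  { unfold k0. apply sqrt_sqrt. lra. }
  assert (E2 : sqrt (1 - 2 * beta) * sqrt (1 - 2 * beta) = 1 - 2 * beta) by (apply sqrt_sqrt; lra).
  set (k := k0 mu beta) in *. set (kap := sqrt (1 - 2 * beta)) in *.
  pose proof (pow2_ge_0 mu).
  apply Rle_div_r; [exact Hka|].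
  assert (k <= kap) by nra.
  rewrite Rabs_left1 by lra. nra.
Qed.

Lemma Hk_continuous (mu beta : R) (n : Z) (x : R) : continuous (Hk mu beta n) x.
Proof.
  unfold Hk.
  assert (Cabs : forall k, continuous (fun x => k * Rabs x) x).
  { intro k. apply (continuous_scal_r (V := R_NormedModule)), continuous_Rabs. }
  assert (Cexp : forall k, continuous (fun x => exp (k * Rabs x)) x).
  { intro k. apply continuous_exp_comp, Cabs. }
  destruct (Z.eq_dec n 0); [|destruct (Z.eq_dec n (-1))].
  - unfold Cdiv. apply continuous_Cmult; [|apply continuous_const].
    apply continuous_Cmult; [apply continuous_const|]. apply continuous_cexpi, Cabs.
  - apply continuous_RtoC. unfold Rdiv.
    apply (continuous_mult (K := R_AbsRing)); [|apply continuous_const].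
    apply (continuous_minus (V := R_NormedModule)); [apply Cexp|apply continuous_const].
  - apply continuous_RtoC. unfold Rdiv.
    apply (continuous_mult (K := R_AbsRing)); [apply Cexp|apply continuous_const].
Qed.

(* [mu = 0] is included: there Rocq's division by [0] makes [H_{-1}] vanish. *)
Lemma Hk_uniform_bounds (beta L : R) :
  0 < beta < 1 / 2 -> 0 <= L ->
  exists K, 0 <= K /\ forall mu, Rabs mu <= 1 -> mu ^ 2 <= 3 / 4 * (1 - 2 * beta) ->
    (forall n x, Rabs x <= L -> Cmod (Hk mu beta n x) <= K) /\
    (forall n x y, Rabs x <= L -> Rabs y <= L ->
       Cmod (Hk mu beta n x - Hk mu beta n y) <= K * Rabs (x - y)).
Proof.
  intros Hb HL.
  set (kap := sqrt (1 - 2 * beta)). set (sb := sqrt (4 * beta)).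
  assert (Hkap : 0 < kap) by (apply sqrt_lt_R0; lra).
  assert (Hsb : 0 < sb) by (apply sqrt_lt_R0; lra).
  assert (I1 : 0 < / kap) by now apply Rinv_0_lt_compat.
  assert (I2 : 0 < / sb) by now apply Rinv_0_lt_compat.
  pose proof (exp_pos L) as HE.
  assert (HEL : 0 <= exp L * L) by (apply Rmult_le_pos; lra).
  (* In order: the size and the Lipschitz constant of [H_0], the size of the decaying modes, the
     Lipschitz constant of the real kernels, the size of [H_{-1}]. *)
  set (K := / kap + 1 + / sb + exp L + exp L * L).
  assert (HK1 : 1 <= K) by (unfold K; lra).
  exists K. split; [lra|]. intros mu Hmu Hmu2.
  pose proof (k0_lower mu beta Hb Hmu2) as Hk0. fold kap in Hk0.
  set (k := k0 mu beta) in *.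
  assert (Hk2 : RtoC (2 * k) <> RtoC 0) by (intro E; apply RtoC_inj in E; lra).
  assert (HexpK : forall z, z <= L -> exp (Rmax z 0) <= K).
  { intros z Hz. apply Rle_trans with (exp L); [|unfold K; lra].
    apply exp_le_mono. now apply Rmax_lub. }
  assert (Hneg : forall u, 0 <= u <= L -> - mu * u <= L).
  { intros u Hu. apply Rabs_le_between in Hmu. nra. }
  assert (Habs : forall x y, Rabs (Rabs x - Rabs y) <= Rabs (x - y))
    by (intros; apply Rabs_triang_inv2).
  (* The kernels depend on [x] through [|x|] only, and the absolute value is 1-Lipschitz. *)
  assert (Hlift : forall a x y, a <= K * Rabs (Rabs x - Rabs y) -> a <= K * Rabs (x - y)).
  { intros a x y Ha. eapply Rle_trans; [exact Ha|]. apply Rmult_le_compat_l; [lra|apply Habs]. }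
  split.
  - intros n x Hx. pose proof (Rabs_pos x) as Hx0. unfold Hk.
    destruct (Z.eq_dec n 0) as [_|Hn0]; [|destruct (Z.eq_dec n (-1)) as [_|Hn1]].
    + fold k. rewrite Cmod_div, Cmod_mult, Cmod_Ci, Cmod_cexpi, Cmod_R, (Rabs_pos_eq (2 * k))
        by (exact Hk2 || lra).
      apply Rle_trans with (/ kap); [|unfold K; lra].
      unfold Rdiv. rewrite !Rmult_1_l. apply Rinv_le_contravar; lra.
    + rewrite Cmod_R. destruct (Req_dec mu 0) as [->|Hmu0].
      * rewrite Ropp_0, Rmult_0_l, exp_0, Rminus_diag. unfold Rdiv.
        rewrite Rmult_0_l, Rabs_R0. lra.
      (* [H_{-1}] vanishes at 0, so its Lipschitz bound also controls its size, without a factor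
         [1 / mu]. *)
      * pose proof (exp_kernel_lipschitz mu 1 L (Rabs x) 0 Hmu0 (conj Hx0 Hx) (conj (Rle_refl 0) HL)) as H.
        rewrite Rmult_0_r, exp_0, Rminus_diag in H. unfold Rdiv in H at 2.
        rewrite Rmult_0_l, !Rminus_0_r, Rabs_Rabsolu in H.
        eapply Rle_trans; [exact H|].
        apply Rle_trans with (exp L * L); [|unfold K; lra].
        apply Rmult_le_compat; [left; apply exp_pos|exact Hx0| |exact Hx].
        apply exp_le_mono, Rmax_lub; [|exact HL]. apply Hneg. lra.
    + pose proof (km_lower mu beta n Hb Hn0 Hn1) as Hkm. fold sb in Hkm.
      set (q := km mu beta n) in *. rewrite Cmod_R.
      pose proof (exp_pos (- q * Rabs x)).
      rewrite Rabs_div, (Rabs_pos_eq (exp _)), (Rabs_pos_eq (2 * q)) by lra.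
      apply Rle_trans with (/ sb); [|unfold K; lra].
      apply Rle_trans with (1 / (2 * q)).
      * apply Rmult_le_compat_r; [left; apply Rinv_0_lt_compat; lra|].
        rewrite <- exp_0. apply exp_le_mono. nra.
      * unfold Rdiv. rewrite Rmult_1_l. apply Rinv_le_contravar; lra.
  - intros n x y Hx Hy. pose proof (Rabs_pos x) as Hx0. pose proof (Rabs_pos y) as Hy0. unfold Hk.
    destruct (Z.eq_dec n 0) as [_|Hn0]; [|destruct (Z.eq_dec n (-1)) as [_|Hn1]].
    + fold k.
      replace (Ci * cexpi (k * Rabs x) / RtoC (2 * k) - Ci * cexpi (k * Rabs y) / RtoC (2 * k))%C
        with (Ci * (cexpi (k * Rabs x) - cexpi (k * Rabs y)) / RtoC (2 * k))%C
        by (unfold Cdiv; ring).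
      rewrite Cmod_div, Cmod_mult, Cmod_Ci, Cmod_R, (Rabs_pos_eq (2 * k)), Rmult_1_l
        by (exact Hk2 || lra).
      apply Rle_div_l; [lra|].
      eapply Rle_trans; [apply cexpi_lipschitz|].
      replace (k * Rabs x - k * Rabs y) with (k * (Rabs x - Rabs y)) by ring.
      rewrite Rabs_mult, (Rabs_pos_eq k) by lra.
      pose proof (Habs x y). pose proof (Rabs_pos (x - y)).
      assert (k * Rabs (Rabs x - Rabs y) <= k * Rabs (x - y)) by (apply Rmult_le_compat_l; lra).
      assert (0 <= (K - 1) * (2 * k * Rabs (x - y))).
      { apply Rmult_le_pos; [lra|]. apply Rmult_le_pos; lra. }
      lra.
    + rewrite <- RtoC_minus, Cmod_R. apply Hlift. destruct (Req_dec mu 0) as [->|Hmu0].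
      * rewrite Ropp_0, !Rmult_0_l, Rminus_diag, Rabs_R0.
        apply Rmult_le_pos; [lra|apply Rabs_pos].
      * eapply Rle_trans; [now apply (exp_kernel_lipschitz mu 1 L)|].
        apply Rmult_le_compat_r; [apply Rabs_pos|]. apply HexpK, Hneg. lra.
    + pose proof (km_lower mu beta n Hb Hn0 Hn1) as Hkm. fold sb in Hkm.
      set (q := km mu beta n) in *. rewrite <- RtoC_minus, Cmod_R. apply Hlift.
      rewrite <- (Rminus_0_r (exp (- q * Rabs x))), <- (Rminus_0_r (exp (- q * Rabs y))).
      eapply Rle_trans; [apply (exp_kernel_lipschitz q 0 L); [lra| |]; lra|].
      apply Rmult_le_compat_r; [apply Rabs_pos|]. apply HexpK. nra.
Qed.

(** * The limit of Q *)

(** Reflection about the midpoint serves both symmetries: on [[-R0, R0]] it is [x -> - x], on a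
    period it is [y -> 2 * PI - y]. *)
Lemma CInt_reflect (g : R -> C) (a b : R) :
  (forall t, continuous g t) -> CInt (fun t => g (a + b - t)) a b = CInt g a b.
Proof.
  intro Hg.
  pose proof (RInt_comp_lin (V := C_R_CompleteNormedModule) g (-1) (a + b) a b
                (ex_CInt_continuous g _ _ Hg)) as H.
  replace (-1 * a + (a + b)) with b in H by ring.
  replace (-1 * b + (a + b)) with a in H by ring.
  rewrite <- (opp_RInt_swap (V := C_R_CompleteNormedModule) g a b) in H
    by now apply ex_CInt_continuous.
  transitivity (opp (RInt (V := C_R_CompleteNormedModule) (fun y => scal (-1) (g (-1 * y + (a + b)))) a b)).
  - rewrite (RInt_scal (V := C_R_CompleteNormedModule) (fun y => g (-1 * y + (a + b)))).
    + etransitivity; [|symmetry; exact (f_equal opp (scal_opp_one (V := C_R_NormedModule) _))].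
      rewrite opp_opp. apply (RInt_ext (V := C_R_CompleteNormedModule)).
      intros t _. f_equal. ring.
    + apply ex_CInt_continuous. intro t.
      apply (continuous_comp (V := R_UniformSpace) (W := C_UniformSpace) (fun t => -1 * t + (a + b)) g).
      * apply (continuous_plus (V := R_NormedModule)); [|apply continuous_const].
        apply (continuous_scal_r (V := R_NormedModule)), continuous_id.
      * apply Hg.
  - exact (eq_trans (f_equal opp H) (opp_opp (G := C_R_CompleteNormedModule) _)).
Qed.

Lemma zweight_le_2 (j : Z) : zweight j <= 2.
Proof.
  unfold zweight. pose proof (IZR_over_bound (j + 1)) as H1. pose proof (IZR_over_bound j) as H2.
  apply Rabs_le_between in H1. apply Rabs_le_between in H2. lra.
Qed.

Lemma cexpi_opp_2PI (j : Z) (y : R) : cexpi (- IZR j * (0 + 2 * PI - y)) = cexpi (IZR j * y).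
Proof.
  unfold cexpi.
  replace (- IZR j * (0 + 2 * PI - y)) with (IZR j * y - IZR j * (2 * PI)) by ring.
  rewrite cos_minus, sin_minus, sin_2PI_IZR, cos_2PI_IZR. f_equal; ring.
Qed.

Lemma fj_even (f : R -> R -> R) (j : Z) (x : R) :
  smooth2 f -> (forall y, f x (y + 2 * PI) = f x y) -> (forall y, f x (- y) = f x y) ->
  fj f (- j) x = fj f j x.
Proof.
  intros Hs Hp He. unfold fj.
  rewrite <- (CInt_reflect (fun y => (cexpi (- IZR j * y) * RtoC (f x y))%C)).
  - apply (RInt_ext (V := C_R_CompleteNormedModule)). intros y _.
    rewrite cexpi_opp_2PI, opp_IZR, Ropp_involutive.
    replace (f x (0 + 2 * PI - y)) with (f x y); [reflexivity|].
    rewrite <- He, <- Hp. f_equal. ring.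
  - apply fourier_integrand_continuous. intro y. now apply (smooth2_continuous_y f nil).
Qed.

(** Evenness in [x] reconciles the exponential [e^{+ i xi x}] occurring in [Q] with the sign
    convention of [ftilde]. *)
Lemma CInt_fj_reflect (f : R -> R -> R) (R0 xi : R) (j : Z) :
  (forall x, continuous (fj f j) x) -> (forall x y, f (- x) y = f x y) ->
  CInt (fun x => (cexpi (xi * x) * fj f j x)%C) (- R0) R0 = ftilde f R0 j xi.
Proof.
  intros Hc He. unfold ftilde.
  rewrite <- (CInt_reflect (fun x => (cexpi (xi * x) * fj f j x)%C)).
  - apply (RInt_ext (V := C_R_CompleteNormedModule)). intros x _.
    replace (- R0 + R0 - x) with (- x) by ring.
    replace (xi * - x) with (- xi * x) by ring. f_equal.
    apply (RInt_ext (V := C_R_CompleteNormedModule)). intros y _. now rewrite He.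
  - intro x. apply continuous_Cmult; [|apply Hc].
    apply continuous_cexpi, (continuous_scal_r (V := R_NormedModule)), continuous_id.
Qed.

(** [1 - beta > 1 / 2] gives positivity; the upper bound makes the operator norm independent of
    [mu]. *)
Lemma gam_bounds (mu beta : R) :
  0 < beta < 1 / 2 -> mu ^ 2 < 1 / 4 -> 0 < gam mu beta /\ 2 * gam mu beta <= 1.
Proof.
  intros Hb Hmu. unfold gam. pose proof PI_RGT_0. pose proof PI2_1 as H1. unfold PI2 in H1.
  pose proof (pow2_ge_0 mu). split.
  - apply Rdiv_lt_0_compat; nra.
  - replace (2 * (((1 - beta) ^ 2 - mu ^ 2) / (4 * PI)))
      with (((1 - beta) ^ 2 - mu ^ 2) / (2 * PI)) by (field; lra).
    apply Rle_div_l; nra.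
Qed.

Lemma resolvent_near_rhs (f : R -> R -> R) (R0 beta : R) :
  0 <= R0 -> smooth2 f -> (forall x y, f x (y + 2 * PI) = f x y) ->
  (forall x y, R0 < Rabs x -> f x y = 0) -> 0 < beta < 1 / 2 ->
  exists E, 0 <= E /\ forall eps mu g Mg,
    Rabs eps * E <= 1 / 2 -> mu ^ 2 < 1 / 4 -> mu ^ 2 <= 3 / 4 * (1 - 2 * beta) ->
    inX R0 g -> (forall n x, Cmod (g n x) <= Mg) ->
    inX R0 (resolvent f R0 eps mu beta g) /\
    forall m x, Cmod (resolvent f R0 eps mu beta g m x - g m x) <= 2 * (Rabs eps * E) * Mg.
Proof.
  intros HR Hs Hp Hf Hb.
  destruct (fj_decay f R0 Hs Hp Hf) as [W [HW [Wb Wl]]].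
  destruct (Hk_uniform_bounds beta (2 * R0) Hb ltac:(lra)) as [K [HK HKb]].
  (* This is [hop_norm] with [Cmod G] replaced by its bound 1. *)
  exists (4 * R0 * K * W). split; [repeat apply Rmult_le_pos; lra|].
  intros eps mu g Mg Heps Hmu Hmu2 Hg HMg.
  assert (HMg0 : 0 <= Mg) by (eapply Rle_trans; [apply Cmod_ge_0|apply (HMg 0%Z 0)]).
  destruct (HKb mu) as [Kb Kl]; [|exact Hmu2|].
  { apply Rabs_le. nra. }
  destruct (gam_bounds mu beta Hb Hmu) as [Hg1 Hg2].
  set (G := RtoC (2 * gam mu beta)).
  assert (HG : Cmod G <= 1) by (unfold G; rewrite Cmod_R, Rabs_pos_eq; lra).
  assert (HE0 : 0 <= 4 * R0 * K * W) by (repeat apply Rmult_le_pos; lra).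
  assert (HE : Rabs eps * hop_norm R0 K W G <= Rabs eps * (4 * R0 * K * W)).
  { apply Rmult_le_compat_l; [apply Rabs_pos|]. unfold hop_norm. nra. }
  assert (csupp : forall j x, R0 < Rabs x -> fj f j x = RtoC 0)
    by (intros; now apply fj_support with R0).
  destruct (affine_hop_fixpoint R0 K W G (Hk mu beta) (fj f) HR HK HW
              (Hk_continuous mu beta) Kb Kl csupp Wb Wl eps Mg g
              ltac:(lra) Hg HMg) as [A [HA [Hfix [HAg Huniq]]]].
  assert (HT : forall A', inX R0 A' -> That_is f R0 mu beta A' (hop R0 G (Hk mu beta) (fj f) A')).
  { intros A' HA' m x.
    exact (hop_spec R0 K W G (Hk mu beta) (fj f) HR HK HW (Hk_continuous mu beta) Kb
             csupp Wb A' m x HA'). }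
  assert (HAs : solves f R0 eps mu beta g A).
  { split; [exact HA|]. exists (hop R0 G (Hk mu beta) (fj f) A). split; [now apply HT|exact Hfix]. }
  assert (HAu : forall A', solves f R0 eps mu beta g A' -> A' = A).
  { intros A' [HA' [B [HB HAB]]]. apply Huniq; [exact HA'|]. intros m x. rewrite HAB.
    do 2 f_equal. apply (Ccv_unique _ _ _ (HB m x) (HT A' HA' m x)). }
  assert (Hres : resolvent f R0 eps mu beta g = A).
  { apply HAu. unfold resolvent.
    apply (epsilon_spec (inhabits (fun _ _ => RtoC 0)) (fun A => solves f R0 eps mu beta g A /\
      forall A', solves f R0 eps mu beta g A' -> A' = A)).
    now exists A. }
  rewrite Hres. split; [exact HA|].
  intros m x. eapply Rle_trans; [apply HAg|]. apply Rmult_le_compat_r; lra.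
Qed.

Lemma fj_continuous (f : R -> R -> R) (R0 : R) (j : Z) (x : R) :
  smooth2 f -> (forall x y, f x (y + 2 * PI) = f x y) -> (forall x y, R0 < Rabs x -> f x y = 0) ->
  continuous (fj f j) x.
Proof.
  intros Hs Hp Hf. destruct (fj_decay f R0 Hs Hp Hf) as [W [_ [_ Wl]]].
  apply continuous_C_lipschitz with (L := W * zweight j). intro y. apply Wl.
Qed.

(** Two errors add up: [D1 * |eps|] from replacing the resolvent by the identity, and [D2 * |mu|]
    from replacing [k0] by its limit. *)
Lemma Qq_limit (f : R -> R -> R) (R0 beta : R) :
  0 <= R0 -> smooth2 f -> (forall x y, f x (y + 2 * PI) = f x y) ->
  (forall x y, R0 < Rabs x -> f x y = 0) ->
  (forall x y, f (- x) y = f x y /\ f x y = f x (- y)) -> 0 < beta < 1 / 2 ->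
  exists D, 0 <= D /\ exists eta, 0 < eta /\ forall eps nu,
    Rabs eps <= eta -> Rabs (eps * nu) <= eta ->
    Cmod (Qq f R0 eps nu beta - ftilde f R0 1 (sqrt (1 - 2 * beta)))
      <= D * (Rabs eps + Rabs (eps * nu)).
Proof.
  intros HR Hs Hp Hf Hsym Hb.
  destruct (fj_decay f R0 Hs Hp Hf) as [W [HW [Wb Wl]]].
  destruct (resolvent_near_rhs f R0 beta HR Hs Hp Hf Hb) as [E [HE Hres]].
  set (kap := sqrt (1 - 2 * beta)).
  assert (Hkap : 0 < kap) by (apply sqrt_lt_R0; lra).
  assert (Hkk : kap * kap = 1 - 2 * beta) by (apply sqrt_sqrt; lra).
  assert (Hik : 0 < / kap) by now apply Rinv_0_lt_compat.
  set (M := 2 * W).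
  assert (HM : forall j x, Cmod (fj f j x) <= M).
  { intros j x. eapply Rle_trans; [apply Wb|]. unfold M. pose proof (zweight_le_2 j). nra. }
  assert (HM0 : 0 <= M) by (unfold M; lra).
  set (D1 := 2 * R0 * (2 * E * M)). set (D2 := 2 * R0 * (2 * (/ kap * R0) * M)).
  assert (HD1 : 0 <= D1) by (unfold D1; repeat apply Rmult_le_pos; lra).
  assert (HD2 : 0 <= D2) by (unfold D2; repeat apply Rmult_le_pos; lra).
  exists (D1 + D2). split; [lra|].
  assert (Heta0 : 0 < / (2 * (E + 1))) by (apply Rinv_0_lt_compat; lra).
  (* The first entry ensures [|eps| * E <= 1 / 2]; [1 / 4] gives [mu ^ 2 < 1 / 4] and
     [mu ^ 2 <= |mu|]; [kap / 2] gives the hypothesis of [k0_lower]. *)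
  exists (Rmin (/ (2 * (E + 1))) (Rmin (1 / 4) (kap / 2))).
  split; [repeat apply Rmin_pos; lra|].
  intros eps nu Heps Hmu. set (mu := eps * nu) in *.
  pose proof (Rmin_l (/ (2 * (E + 1))) (Rmin (1 / 4) (kap / 2))) as L1.
  pose proof (Rmin_r (/ (2 * (E + 1))) (Rmin (1 / 4) (kap / 2))) as L2.
  pose proof (Rmin_l (1 / 4) (kap / 2)) as L3. pose proof (Rmin_r (1 / 4) (kap / 2)) as L4.
  assert (HepsE : Rabs eps * E <= 1 / 2).
  { apply Rle_trans with (/ (2 * (E + 1)) * (E + 1)).
    - apply Rmult_le_compat; try lra. apply Rabs_pos.
    - right. field. lra. }
  pose proof (Rabs_pos mu) as Hmu0. pose proof (Rabs_pos eps) as Heps0.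
  assert (Hmusq : mu ^ 2 = Rabs mu * Rabs mu) by (rewrite <- pow2_abs; ring).
  assert (Hmu1 : mu ^ 2 < 1 / 4) by nra.
  assert (Hmu2 : mu ^ 2 <= 3 / 4 * (1 - 2 * beta)) by nra.
  assert (Hmu3 : mu ^ 2 <= Rabs mu) by nra.
  assert (Cfj : forall j x, continuous (fj f j) x) by (intros; now apply fj_continuous with R0).
  assert (Cexp : forall k j x, continuous (fun x => (cexpi (k * x) * fj f j x)%C) x).
  { intros k j x. apply continuous_Cmult; [|apply Cfj].
    apply continuous_cexpi, (continuous_scal_r (V := R_NormedModule)), continuous_id. }
  assert (Hg1M : forall n x, Cmod (g1 f mu beta n x) <= M).
  { intros n x. unfold g1. rewrite Cmod_mult, Cmod_cexpi, Rmult_1_l. apply HM. }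
  destruct (Hres eps mu (g1 f mu beta) M HepsE Hmu1 Hmu2) as [HX Hclose]; [|exact Hg1M|].
  { split; [|split].
    - intros n x. apply Cexp.
    - intros n x Hx. unfold g1. rewrite (fj_support f R0 n x Hf Hx). ring.
    - now exists M. }
  (* Both symmetries act here: evenness in [x] flips the exponential, evenness in [y] exchanges the
     modes 1 and -1. *)
  assert (Hlim : ftilde f R0 1 kap
    = CInt (fun x => (cexpi (kap * x) * fj f (-1) x)%C) (- R0) R0).
  { rewrite <- CInt_fj_reflect; [|apply Cfj|intros; apply Hsym].
    apply (RInt_ext (V := C_R_CompleteNormedModule)). intros x _. f_equal. symmetry.
    apply (fj_even f 1 x Hs); intro y; [apply Hp|symmetry; apply Hsym]. }
  rewrite Hlim. unfold Qq, avg. fold mu.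
  set (q := CInt (g1 f mu beta (-1)%Z) (- R0) R0).
  set (q1 := CInt (resolvent f R0 eps mu beta (g1 f mu beta) (-1)%Z) (- R0) R0).
  set (q2 := CInt (fun x => (cexpi (kap * x) * fj f (-1) x)%C) (- R0) R0).
  assert (B1 : Cmod (q1 - q) <= D1 * Rabs eps).
  { replace (D1 * Rabs eps) with ((R0 - - R0) * (2 * (Rabs eps * E) * M)) by (unfold D1; ring).
    apply Cmod_CInt_minus_le; [lra| | |].
    - intro t. apply HX.
    - intro t. apply Cexp.
    - intros t _. apply Hclose. }
  assert (B2 : Cmod (q - q2) <= D2 * Rabs mu).
  { replace (D2 * Rabs mu) with ((R0 - - R0) * (2 * (/ kap * R0) * M * Rabs mu)) by (unfold D2; ring).
    apply Cmod_CInt_minus_le; [lra| | |].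
    - intro t. apply Cexp.
    - intro t. apply Cexp.
    - intros t Ht. unfold g1.
      replace (cexpi (k0 mu beta * t) * fj f (-1) t - cexpi (kap * t) * fj f (-1) t)%C
        with ((cexpi (k0 mu beta * t) - cexpi (kap * t)) * fj f (-1) t)%C by ring.
      rewrite Cmod_mult.
      replace (2 * (/ kap * R0) * M * Rabs mu) with (2 * (Rabs mu / kap * R0) * M)
        by (unfold Rdiv; ring).
      apply Rmult_le_compat; try apply Cmod_ge_0; [|apply HM].
      eapply Rle_trans; [apply cexpi_lipschitz|]. apply Rmult_le_compat_l; [lra|].
      replace (k0 mu beta * t - kap * t) with ((k0 mu beta - kap) * t) by ring.
      rewrite Rabs_mult.
      apply Rmult_le_compat; try apply Rabs_pos; [|now apply Rabs_le].
      eapply Rle_trans; [now apply k0_limit|].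
      apply Rmult_le_compat_r; [left; exact Hik|exact Hmu3]. }
  replace (q1 - q2)%C with ((q1 - q) + (q - q2))%C by ring.
  eapply Rle_trans; [apply Cmod_triangle|]. nra.
Qed.

(** * Nonvanishing of the denominator along the two branches *)

Lemma real_analytic_continuous (g : R -> R) (a b x0 : R) :
  real_analytic_on g a b -> a < x0 < b -> continuity_pt g x0.
Proof.
  intros Hg Hx. destruct (Hg x0 Hx) as [c [r [Hr Hc]]].
  assert (Hser : forall x, Rabs (x - x0) < r -> PSeries c (x - x0) = g x).
  { intros x Hxr. apply is_pseries_unique. now apply Hc. }
  (* The radius of convergence is positive: the series converges at [r / 2], so its terms tend to 0
     there and [r / 2] is not outside the disk. *)
  assert (HCV : Rbar_lt (Rabs (x0 - x0)) (CV_radius c)).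
  { rewrite Rminus_diag, Rabs_R0.
    apply Rbar_lt_le_trans with (Finite (Rabs (r / 2))).
    - simpl. rewrite Rabs_pos_eq; lra.
    - apply Rbar_not_lt_le. intro Hlt.
      apply (CV_disk_outside c (r / 2) Hlt).
      assert (Hs : ex_series (fun n => c n * (r / 2) ^ n)).
      { exists (g (x0 + r / 2)).
        apply is_pseries_R. replace (r / 2) with (x0 + r / 2 - x0) at 1 by ring.
        apply Hc. replace (x0 + r / 2 - x0) with (r / 2) by ring. rewrite Rabs_pos_eq; lra. }
      exact (ex_series_lim_0 _ Hs). }
  apply continuity_pt_filterlim.
  apply (continuous_ext_loc g (fun x => PSeries c (x - x0)) x0).
  - exists (mkposreal r Hr). intros x Hxr. apply Hser. exact Hxr.
  - apply (continuous_comp (fun x => x - x0) (PSeries c)).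
    + apply (continuous_minus (V := R_NormedModule)); [apply continuous_id|apply continuous_const].
    + apply continuity_pt_filterlim. now apply PSeries_continuity.
Qed.


Lemma Qq_eventually_nonzero (f : R -> R -> R) (R0 beta : R) (nu : R -> R) :
  0 <= R0 -> smooth2 f -> (forall x y, f x (y + 2 * PI) = f x y) ->
  (forall x y, R0 < Rabs x -> f x y = 0) ->
  (forall x y, f (- x) y = f x y /\ f x y = f x (- y)) -> 0 < beta < 1 / 2 ->
  ftilde f R0 1 (sqrt (1 - 2 * beta)) <> RtoC 0 -> continuity_pt nu 0 ->
  exists eps0, 0 < eps0 /\ forall eps, 0 < eps < eps0 ->
    Qq f R0 eps (nu eps) beta <> RtoC 0 /\
    0 < gam (eps * nu eps) beta /\ 0 < k0 (eps * nu eps) beta.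
Proof.
  intros HR Hs Hp Hf Hsym Hb Hq Hnu.
  destruct (Qq_limit f R0 beta HR Hs Hp Hf Hsym Hb) as [D [HD [eta [Heta HQ]]]].
  set (q := ftilde f R0 1 (sqrt (1 - 2 * beta))) in *.
  set (kap := sqrt (1 - 2 * beta)) in *.
  assert (Hkap : 0 < kap) by (apply sqrt_lt_R0; lra).
  assert (Hkk : kap * kap = 1 - 2 * beta) by (apply sqrt_sqrt; lra).
  assert (Hq0 : 0 < Cmod q) by now apply Cmod_gt_0.
  set (N := Rabs (nu 0) + 1).
  assert (HN : 1 <= N) by (unfold N; pose proof (Rabs_pos (nu 0)); lra).
  destruct (Hnu 1 Rlt_0_1) as [delta [Hdelta Hnud]].
  (* The last entry gives [D * (|eps| + |mu|) <= 2 * D * t <= Cmod q / 2], too small for [Q = 0];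
     the others meet the hypotheses of [Qq_limit], [gam_bounds] and [k0_lower]. *)
  set (t := Rmin (Rmin eta (1 / 4)) (Rmin (kap / 2) (Cmod q / (4 * (D + 1))))).
  assert (Hr : 0 < Cmod q / (4 * (D + 1))) by (apply Rdiv_lt_0_compat; lra).
  assert (Ht : 0 < t) by (unfold t; repeat apply Rmin_pos; lra).
  assert (Ht1 : t <= eta) by (eapply Rle_trans; [apply Rmin_l|apply Rmin_l]).
  assert (Ht2 : t <= 1 / 4) by (eapply Rle_trans; [apply Rmin_l|apply Rmin_r]).
  assert (Ht3 : t <= kap / 2) by (eapply Rle_trans; [apply Rmin_r|apply Rmin_l]).
  assert (Ht4 : t <= Cmod q / (4 * (D + 1))) by (eapply Rle_trans; [apply Rmin_r|apply Rmin_r]).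
  apply Rle_div_r in Ht4; [|lra].
  (* [N >= 1] bounds [|nu|] near 0, so [eps < t / N] keeps both [eps] and [|mu|] below [t]. *)
  exists (Rmin delta (t / N)). split; [apply Rmin_pos; [exact Hdelta|apply Rdiv_lt_0_compat; lra]|].
  intros eps [He He0].
  assert (He1 : eps < delta) by (eapply Rlt_le_trans; [exact He0|apply Rmin_l]).
  assert (He2 : eps * N < t).
  { apply Rlt_div_r; [lra|]. eapply Rlt_le_trans; [exact He0|apply Rmin_r]. }
  assert (HnuN : Rabs (nu eps) <= N).
  { assert (Hd : Rabs (nu eps - nu 0) < 1).
    { apply Hnud. split; [split; [exact I|lra]|].
      simpl. unfold Rdist. rewrite Rminus_0_r, Rabs_pos_eq; lra. }
    pose proof (Rabs_triang_inv (nu eps) (nu 0)). unfold N. lra. }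
  assert (Hmu : Rabs (eps * nu eps) <= t).
  { rewrite Rabs_mult, (Rabs_pos_eq eps) by lra. nra. }
  set (mu := eps * nu eps) in *. pose proof (Rabs_pos mu) as Hmu0.
  assert (Hmusq : mu ^ 2 = Rabs mu * Rabs mu) by (rewrite <- pow2_abs; ring).
  assert (Heabs : Rabs eps <= t) by (rewrite Rabs_pos_eq; nra).
  split; [|split].
  - intro E.
    assert (HQe : Cmod (Qq f R0 eps (nu eps) beta - q) <= D * (Rabs eps + Rabs mu))
      by (apply HQ; fold mu; lra).
    rewrite E in HQe. replace (0 - q)%C with (- q)%C in HQe by ring. rewrite Cmod_opp in HQe.
    assert (D * (Rabs eps + Rabs mu) <= D * (2 * t)) by (apply Rmult_le_compat_l; lra).
    nra.
  - apply gam_bounds; [exact Hb|]. nra.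
  - eapply Rlt_le_trans; [|apply k0_lower; [exact Hb|]].
    + fold kap. lra.
    + nra.
Qed.

(** The expression is what is left of [acoef], and equally of [bcoef], when [ell = 0]. *)
Lemma source_term_neq_0 (k eps g : R) (q : C) :
  0 < k -> 0 < eps -> 0 < g -> q <> RtoC 0 ->
  (Ci / RtoC k * RtoC (eps * g) * (RtoC g * (q * q)))%C <> RtoC 0.
Proof.
  intros Hk He Hg Hq.
  assert (HR : forall r, 0 < r -> RtoC r <> RtoC 0) by (intros r Hr E; apply RtoC_inj in E; lra).
  repeat apply Cmult_neq_0; try assumption.
  - intro E. injection E. lra.
  - intro E. apply C1_nz. rewrite <- (Cinv_r (RtoC k)), E by now apply HR. apply Cmult_0_r.
  - apply HR. now apply Rmult_lt_0_compat.
  - now apply HR.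
Qed.

Theorem theorem6p4
  (f : R -> R -> R) (R0 : R)
  (Hf : admissible_f f R0)
  (Hsym : forall x y, f (- x) y = f x y /\ f x y = f x (- y))
  (beta : R) (Hbeta : 0 < beta < 1 / 2)
  (Hf1 : ftilde f R0 1 (sqrt (1 - 2 * beta)) <> RtoC 0)
  (Hf0 : ftilde f R0 0 (2 * sqrt (1 - 2 * beta)) <> RtoC 0)
  (Hnua0 : 0 < nu_a0 f R0 beta)
  (nua nub : R -> R) (da db : R)
  (Hda : 0 < da) (Hdb : 0 < db)
  (Hnua_an : real_analytic_on nua (- da) da)
  (Hnub_an : real_analytic_on nub (- db) db)
  (Hnua_0 : nua 0 = nu_a0 f R0 beta)
  (Hnub_0 : nub 0 = nu_b0 f R0 beta)
  (Hnua_eq : forall eps, 0 < eps < da -> acoef f R0 eps (nua eps) beta = RtoC 0)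
  (Hnub_eq : forall eps, 0 < eps < db -> bcoef f R0 eps (nub eps) beta = RtoC 0) :
  exists eps0, 0 < eps0 /\
    forall eps, 0 < eps < eps0 ->
      (ell f R0 eps (nua eps) beta <> RtoC 0 /\ Rcoef f R0 eps (nua eps) beta = RtoC 0) /\
      (ell f R0 eps (nub eps) beta <> RtoC 0 /\ Tcoef f R0 eps (nub eps) beta = RtoC 0).
Proof.
  destruct Hf as [Hs [Hp [Hsupp _]]].
  (* A negative [R0] would force [f = 0] everywhere, contradicting [Hf1]. *)
  assert (HR : 0 <= R0).
  { apply Rnot_lt_le. intro HR. apply Hf1. apply CInt_0. intro x.
    rewrite (fj_support f R0 1 x Hsupp); [apply Cmult_0_r|].
    pose proof (Rabs_pos x). lra. }
  assert (Hca : continuity_pt nua 0) by (apply (real_analytic_continuous _ _ _ _ Hnua_an); lra).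
  assert (Hcb : continuity_pt nub 0) by (apply (real_analytic_continuous _ _ _ _ Hnub_an); lra).
  destruct (Qq_eventually_nonzero f R0 beta nua HR Hs Hp Hsupp Hsym Hbeta Hf1 Hca)
    as [ea [Hea Ha]].
  destruct (Qq_eventually_nonzero f R0 beta nub HR Hs Hp Hsupp Hsym Hbeta Hf1 Hcb)
    as [eb [Heb Hb]].
  exists (Rmin (Rmin ea da) (Rmin eb db)). split; [repeat apply Rmin_pos; assumption|].
  intros eps [He He'].
  apply Rmin_Rgt_l in He'. destruct He' as [He1 He2].
  apply Rmin_Rgt_l in He1. apply Rmin_Rgt_l in He2.
  destruct (Ha eps) as [Qa [ga ka]]; [lra|]. destruct (Hb eps) as [Qb [gb kb]]; [lra|].
  assert (Ea := Hnua_eq eps ltac:(lra)). assert (Eb := Hnub_eq eps ltac:(lra)).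
  split; split.
  - intro E. apply (source_term_neq_0 _ eps _ _ ka He ga Qa). rewrite <- Ea.
    unfold acoef. rewrite E. ring.
  - unfold Rcoef, Cdiv. rewrite Ea. apply Cmult_0_l.
  - intro E. apply (source_term_neq_0 _ eps _ _ kb He gb Qb). rewrite <- Eb.
    unfold bcoef. rewrite E. ring.
  - unfold Tcoef, Cdiv. rewrite Eb. apply Cmult_0_l.
Qed.
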